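(* Let $R>0$ and let $u:B(0,R)\to\mathbb{R}$ be a harmonic function on the open ball $B(0,R)\subset\mathbb{R}^d$ of radius $R$ centered at $0$. Define $$q_u(r):=\frac{1}{|S^{d-1}(r)|}\int_{S^{d-1}(r)}u^2\,d\sigma_r .$$ Then the function $q_u$ is absolutely monotonic in $[0,R)$.
   Context: $S^{d-1}(r)$ is the sphere of radius $r$ centered at $0$ in $\mathbb{R}^d$, $\sigma_r$ its surface measure and $|S^{d-1}(r)|$ its total surface area; at $r=0$ the average is understood as $q_u(0)=u(0)^2$. A $C^\infty$-function $f:[0,T)\to\mathbb{R}$ is called absolutely monotonic in $[0,T)$ if $f$ and all its derivatives are non-negative on $[0,T)$ (one-sided derivatives at $0$). *)

(* Defs.v *)
From HB Require Import structures.
From mathcomp Require Import all_boot all_order all_algebra.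
From mathcomp Require Import all_classical all_reals all_analysis.
From mathcomp Require Import measurable_realfun.

Set Implicit Arguments.
Unset Strict Implicit.
Unset Printing Implicit Defensive.

Import Order.TTheory GRing.Theory Num.Theory.
Import numFieldNormedType.Exports.

Local Open Scope classical_set_scope.
Local Open Scope ring_scope.

(* R^d is 'rV[R]_d. Its library norm is the sup norm, which gives the usual
   topology, but balls and spheres must be taken for the Euclidean norm. *)
Section euclidean.
Context {R : realType} {d : nat}.
Implicit Types (x : 'rV[R]_d) (r : R).

Definition enorm x : R := Num.sqrt (\sum_(i < d) x ord0 i ^+ 2).

Definition eball r : set 'rV[R]_d := [set x | enorm x < r].

Definition esphere r : set 'rV[R]_d := [set x | enorm x = r].

End euclidean.

Section harmonic.
Context {R : realType} {d : nat}.
Implicit Types (u : 'rV[R]_d -> R) (i j : 'I_d) (A : set 'rV[R]_d).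

Definition partial i u : 'rV[R]_d -> R := 'D_(delta_mx ord0 i) u.

Definition has_partial i u x : Prop := derivable u x (delta_mx ord0 i).

(* To be used with A open. *)
Definition C2_on A u : Prop :=
  [/\ forall x, A x -> {for x, continuous u},
      forall i x, A x ->
        has_partial i u x /\ {for x, continuous (partial i u)} &
      forall i j x, A x ->
        has_partial j (partial i u) x /\
        {for x, continuous (partial j (partial i u))}].

Definition laplacian u x : R := \sum_(i < d) partial i (partial i u) x.

Definition harmonic_on A u : Prop :=
  C2_on A u /\ forall x, A x -> laplacian u x = 0.

End harmonic.

(* The sigma-algebra on 'rV[T]_n generated by the coordinates, as the library
   does for n.-tuple T; for T = R it is the Borel sigma-algebra of R^n. *)
Definition measure_rV_display : measure_display -> measure_display.
Proof. exact. Qed.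

Section measurable_rV.
Context {d} {T : sigmaRingType d}.
Variable n : nat.

Let coors : 'I_n -> 'rV[T]_n -> T := fun i x => x ord0 i.

Let rV_set0 : g_sigma_preimage coors set0.
Proof. exact: sigma_algebra0. Qed.

Let rV_setC A : g_sigma_preimage coors A -> g_sigma_preimage coors (~` A).
Proof. exact: sigma_algebraC. Qed.

Let rV_bigcup (F : _^nat) : (forall i, g_sigma_preimage coors (F i)) ->
  g_sigma_preimage coors (\bigcup_i (F i)).
Proof. exact: sigma_algebra_bigcup. Qed.

HB.instance Definition _ := @isMeasurable.Build (measure_rV_display d)
  'rV[T]_n (g_sigma_preimage coors) rV_set0 rV_setC rV_bigcup.

End measurable_rV.

Lemma measurable_coord d (T : sigmaRingType d) n (i : 'I_n) :
  measurable_fun [set: 'rV[T]_n] (fun x : 'rV[T]_n => x ord0 i).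
Proof.
move=> _ Y mY; rewrite setTI; apply: sub_sigma_algebra => /=.
rewrite -bigcup_seq/=; exists i => /=; first by rewrite mem_index_enum.
by exists Y => //; rewrite setTI.
Qed.

Lemma measurable_fun_coordP d1 d2 (T1 : measurableType d1)
    (T2 : measurableType d2) n (f : T1 -> 'rV[T2]_n) :
  (forall i, measurable_fun [set: T1] (fun x => f x ord0 i)) ->
  measurable_fun [set: T1] f.
Proof.
move=> mf; pose h (i : 'I_n) x := f x ord0 i.
have hm : g_sigma_preimage h `<=` measurable.
  apply: smallest_sub; first exact: sigma_algebra_measurable.
  rewrite -bigcup_seq; apply: bigcup_sub => i _ A [B mB <-]; exact: mf.
move=> _ A mA; apply: hm.
by rewrite (g_sigma_preimage_comp (fun i (x : 'rV[T2]_n) => x ord0 i) f); exists A.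
Qed.

(* Lebesgue measure on R^n, by R^(n+1) = R x R^n. *)
Section lebesgue_rV.
Context {R : realType}.

Definition cons_rV n (p : measurableTypeR R * 'rV[R]_n) : 'rV[R]_n.+1 :=
  \row_i (if unlift ord0 i is Some j then p.2 ord0 j else p.1).

Lemma measurable_cons_rV n : measurable_fun setT (@cons_rV n).
Proof.
apply: measurable_fun_coordP => i; case: (unliftP ord0 i) => [j|] ->.
  rewrite (_ : (fun _ => _) = (fun x : 'rV[R]_n => x ord0 j) \o snd).
    by apply: measurableT_comp => //; exact: measurable_coord.
  by apply/funext => p /=; rewrite mxE liftK.
rewrite (_ : (fun _ => _) = fst)//.
by apply/funext => p /=; rewrite mxE unlift_none.
Qed.

Section step.
Variables (n : nat) (mu : {sigma_finite_measure set 'rV[R]_n -> \bar R}).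

Definition lebesgue_rV_step : set 'rV[R]_n.+1 -> \bar R :=
  pushforward (@lebesgue_measure R \x mu)%E (@cons_rV n).

Let step_measure : {measure set 'rV[R]_n.+1 -> \bar R} :=
  measure_function_pushforward__canonical__measure_function_Measure
    (@lebesgue_measure R \x mu)%E (@measurable_cons_rV n).

HB.instance Definition _ := isMeasure.Build _ _ _ lebesgue_rV_step
  (measure0 step_measure) (measure_ge0 step_measure)
  (@measure_semi_sigma_additive _ _ _ step_measure).

Let step_sigma_finite : sigma_finite setT lebesgue_rV_step.
Proof.
have /sigma_finiteP[F [TF ndF Foo]] := sigma_finiteT (@lebesgue_measure R).
have /sigma_finiteP[G [TG ndG Goo]] := sigma_finiteT mu.
pose uncons (x : 'rV[R]_n.+1) : measurableTypeR R * 'rV[R]_n :=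
  (x ord0 ord0, \row_j x ord0 (lift ord0 j)).
have consK : cancel (@cons_rV n) uncons.
  move=> [a v]; rewrite /uncons /cons_rV mxE unlift_none; congr pair.
  by apply/rowP => j; rewrite !mxE liftK.
have munc : measurable_fun setT uncons.
  apply/measurable_fun_pairP; split; first exact: measurable_coord.
  apply: measurable_fun_coordP => j.
  rewrite (_ : (fun _ => _) = fun x : 'rV[R]_n.+1 => x ord0 (lift ord0 j)).
    exact: measurable_coord.
  by apply/funext => x; rewrite mxE.
exists (fun k => uncons @^-1` (F k `*` G k)).
  rewrite -preimage_bigcup -(preimage_setT uncons); congr (_ @^-1` _).
  rewrite -setXTT TF TG predeqE => -[x y]; split.
    move=> [/= [m _ Fmx] [k _ Gky]]; exists (maxn m k) => //; split.
    - by move: x Fmx; exact/subsetPset/ndF/leq_maxl.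
    - by move: y Gky; exact/subsetPset/ndG/leq_maxr.
  by move=> [m _ []/= ? ?]; split; exists m.
move=> k; have [mFk Fkoo] := Foo k; have [mGk Gkoo] := Goo k; split.
  by rewrite -[X in measurable X]setTI; apply: munc => //; exact: measurableX.
rewrite /lebesgue_rV_step /pushforward -comp_preimage.
rewrite (_ : _ \o _ = id) ?preimage_id; last exact/funext/consK.
by rewrite product_measure1E// lte_mul_pinfty// ge0_fin_numE.
Qed.

HB.instance Definition _ := Measure_isSigmaFinite.Build _ _ _ lebesgue_rV_step
  step_sigma_finite.

End step.

Fixpoint lebesgue_rV n : {sigma_finite_measure set 'rV[R]_n -> \bar R} :=
  match n with
  | 0 => \d_(0 : 'rV[R]_0)
  | n.+1 => lebesgue_rV_step (lebesgue_rV n)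
  end.

End lebesgue_rV.

Section surface_measure.
Context {R : realType}.
Variable d : nat.
Implicit Types (r : R) (x : 'rV[R]_d).

(* The point of the sphere of radius r on the ray through x; 0 if x = 0. *)
Definition radial_proj r x : 'rV[R]_d := (r / enorm x) *: x.

Definition punctured_cball r : set 'rV[R]_d := [set x | 0 < enorm x <= r].

Lemma measurable_enorm : measurable_fun setT (@enorm R d).
Proof.
apply: measurableT_comp.
  by apply: continuous_measurable_fun; exact: sqrt_continuous.
apply: measurable_sum => i; apply: measurable_funX; exact: measurable_coord.
Qed.

Lemma measurable_radial_proj r : measurable_fun setT (radial_proj r).
Proof.
have minv : measurable_fun setT (@GRing.inv R).
  rewrite -(setvU [set 0 : R]); apply/measurable_funU => //.
    exact: measurableC.
  split.
    apply: open_continuous_measurable_fun.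
      by apply: closed_openC; exact: closed_eq.
    by move=> x; rewrite inE => /= /eqP x0; exact: inv_continuous.
  exact: measurable_fun_set1.
apply: measurable_fun_coordP => i.
rewrite (_ : (fun _ => _) = fun x : 'rV[R]_d => r / enorm x * x ord0 i).
  apply: measurable_funM; last exact: measurable_coord.
  apply: measurable_funM => //; apply: measurableT_comp => //.
  exact: measurable_enorm.
by apply/funext => x; rewrite mxE.
Qed.

Lemma measurable_punctured_cball r : measurable (punctured_cball r).
Proof.
rewrite (_ : punctured_cball r = @enorm R d @^-1` `]0, r]%classic).
  by rewrite -[X in measurable X]setTI; apply: measurable_enorm.
by apply/seteqP; split => x; rewrite /= in_itv.
Qed.

(* Surface measure of the sphere of radius r > 0, by polar coordinates:
     sigma_r(E) = (d / r) * vol {t *: x | 0 < t <= 1, x \in E}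
   for E included in the sphere; the cone over E is the set of the points of
   the punctured closed ball that radial_proj r sends to E. The normalization
   is the usual one: the total mass is the derivative in r of the volume of the
   ball of radius r (2 for d = 1, where sigma_r is the counting measure on
   {-r, r}). *)
Definition surface_measure r : set 'rV[R]_d -> \bar R := fun E =>
  ((d%:R / `|r|)%:E *
   lebesgue_rV d (radial_proj r @^-1` E `&` punctured_cball r))%E.

Section instance.
Variable r : R.

Let surface : {measure set 'rV[R]_d -> \bar R} :=
  mscale (d%:R / `|r|)%:nng
    (measure_function_pushforward__canonical__measure_function_Measure
      (mrestr (@lebesgue_rV R d) (measurable_punctured_cball r))
      (@measurable_radial_proj r)).

HB.instance Definition _ := isMeasure.Build _ _ _ (surface_measure r)
  (measure0 surface) (measure_ge0 surface)
  (@measure_semi_sigma_additive _ _ _ surface).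

End instance.

(* Only r >= 0 is meaningful; at r = 0 the average is the value at 0. *)
Definition sphere_average (f : 'rV[R]_d -> R) r : R :=
  if r == 0 then f 0
  else (fine (surface_measure r (esphere r)))^-1 *
       \int[surface_measure r]_(x in esphere r) f x.

End surface_measure.

Section absolutely_monotonic.
Context {R : realType}.
Implicit Types (A : set R) (f : R -> R) (x T : R) (n : nat).

(* Derivative along A: at an interior point of A it is the usual derivative,
   at an end point that belongs to A the one-sided derivative. *)
Definition derivable_along A f x : Prop :=
  cvg ((f y - f x) / (y - x) @[y --> within A x^']).

Definition derive_along A f x : R :=
  lim ((f y - f x) / (y - x) @[y --> within A x^']).

Definition derive_alongn A n f : R -> R := iter n (derive_along A) f.

Definition smooth_along A f : Prop :=
  forall n x, A x -> derivable_along A (derive_alongn A n f) x.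

Definition absolutely_monotonic T f : Prop :=
  smooth_along `[0, T[%classic f /\
  forall n x, `[0, T[%classic x -> 0 <= derive_alongn `[0, T[%classic n f x.

End absolutely_monotonic.

(* Main.v *)
Require Import Defs.
From mathcomp Require Import all_boot all_order all_algebra.
From mathcomp Require Import all_classical all_reals all_analysis.
From mathcomp Require Import measurable_realfun.
From mathcomp Require Import ring lra.
From mathcomp Require Import zify.
From mathcomp Require mpoly.

Import -(notations) mpoly.

Set Implicit Arguments.
Unset Strict Implicit.
Unset Printing Implicit Defensive.

Import Order.TTheory GRing.Theory Num.Theory.
Import numFieldNormedType.Exports.

Local Open Scope classical_set_scope.
Local Open Scope ring_scope.

(* On a closed ball of radius r < rho, u is a uniform limit of harmonic
   polynomials: approximate u on the sphere by polynomials (Bernstein), replace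
   each of them by the harmonic polynomial with the same values on the sphere
   (Fischer decomposition), and use the maximum principle.
   For a harmonic polynomial h with homogeneous components h_k, the average of
   h^2 over the sphere of radius r is \sum_k r^(2k) c_k, where c_k >= 0 is the
   average of h_k^2 over the unit sphere. This is derived from rotation
   invariance alone: the averages of (x_i d_j - x_j d_i) p vanish, hence
   m (m + d - 2) A_r(p) = r^2 A_r(Delta p) for p homogeneous of degree m, and
   Delta (f g) = 2 grad f . grad g for f, g harmonic allows an induction on the
   degree.
   So q_u is a pointwise limit on [0, rho[ of polynomials with nonnegative
   coefficients, and such a limit is absolutely monotonic because its derivative
   exists and is again such a limit. *)

(** * Pointwise limits of polynomials with nonnegative coefficients *)

Section absolutely_monotonic_limits.
Context {R : realType}.
Implicit Types (x y s t T : R) (k n : nat) (p : {poly R}) (f : R -> R).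

(** No integral is ever differentiated. [surface_measure] is defined by Lebesgue measures of cones,
    so its symmetries have to come from those of Lebesgue measure, and Fubini gives these for maps
    that move one coordinate at a time. A rotation is a product of three shears of this kind;
    parametrising it by the tangent [t] of its half-angle keeps every formula rational in [t].
    Reading the invariance of averages to first order at [t = 0] then gives an algebraic substitute
    for the divergence theorem. Since [u] need not extend continuously to the closed ball,
    polynomial approximation is available only on smaller balls, and only pointwise convergence on
    [[0, rho[] is retained. It suffices because nonnegative coefficients are rigid: the value of
    such a polynomial at one point [t] bounds its second-order Taylor remainders on every [[0, s]]
    with [s < t]. A convergent sequence is bounded at [t], so these bounds are uniform along the
    sequence, the one-sided situation at 0 included. *)

Fixpoint taylor_quot k x y : R :=
  if k is j.+1 then y * taylor_quot j x y + x ^+ j.-1 *+ j else 0.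

(** [taylor_quot k x y] is the divided difference of [X^k] at the nodes [x, x, y], that is, the sum
    of [j x^(j-1) y^(k-1-j)] over [j < k]. Its coefficients are nonnegative, hence its sign and its
    monotonicity in both arguments. *)
Lemma taylor_quotE k x y :
  y ^+ k - x ^+ k - x ^+ k.-1 *+ k * (y - x) = (y - x) ^+ 2 * taylor_quot k x y.
Proof.
elim: k => [|k IH] /=; first by rewrite !expr0; ring.
transitivity (y * ((y - x) ^+ 2 * taylor_quot k x y)
    + (y - x) ^+ 2 * (x ^+ k.-1 *+ k)); last by ring.
rewrite -IH; case: k {IH} => [|k] /=; first by rewrite !expr0 expr1; ring.
by rewrite !exprS; ring.
Qed.

Lemma taylor_quot_ge0 k x y : 0 <= x -> 0 <= y -> 0 <= taylor_quot k x y.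
Proof.
move=> x0 y0; elim: k => //= k IH.
by rewrite addr_ge0 ?mulr_ge0 ?mulrn_wge0 ?exprn_ge0.
Qed.

Lemma taylor_quot_le k x y s t : 0 <= x <= s -> 0 <= y <= t ->
  taylor_quot k x y <= taylor_quot k s t.
Proof.
move=> /andP[x0 xs] /andP[y0 yt]; elim: k => //= k IH.
apply: lerD; first by rewrite ler_pM// taylor_quot_ge0.
by rewrite lerMn2r lerXn2r ?orbT// nnegrE (le_trans x0).
Qed.

Lemma taylor_quot_bound k s t : 0 <= s -> s <= t ->
  (t - s) ^+ 2 * taylor_quot k s t <= t ^+ k.
Proof.
move=> s0 st; rewrite -taylor_quotE -addrA -opprD gerBl.
by rewrite addr_ge0 ?mulr_ge0 ?mulrn_wge0 ?exprn_ge0 ?subr_ge0.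
Qed.

(** Monotonicity moves each quotient from [(x, y)] to [(s, t)], where [taylor_quot_bound] absorbs it
    into [t^k]; summing against the coefficients rebuilds [p.[t]]. Neither the degree nor the
    individual coefficients enter the bound. *)
Lemma poly_taylor_bound p x y s t : (forall k, 0 <= p`_k) ->
  0 <= x <= s -> 0 <= y <= s -> s < t ->
  `|p.[y] - p.[x] - p^`().[x] * (y - x)| <=
  (y - x) ^+ 2 * (p.[t] / (t - s) ^+ 2).
Proof.
move=> p0 xs ys st.
have s0 : 0 <= s by case/andP: xs => x0 /(le_trans x0).
have ts0 : 0 < (t - s) ^+ 2 by rewrite exprn_gt0// subr_gt0.
have -> : p.[y] - p.[x] - p^`().[x] * (y - x) =
    (y - x) ^+ 2 * \sum_(i < size p) p`_i * taylor_quot i x y.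
  rewrite -{1 2 3}[p]coefK poly_def raddf_sum !horner_sum mulr_suml -!sumrB.
  rewrite mulr_sumr; apply: eq_bigr => i _.
  rewrite /= derivZ derivXn !(hornerZ, hornerMn, hornerXn).
  transitivity (p`_i * ((y - x) ^+ 2 * taylor_quot i x y)); last by ring.
  by rewrite -taylor_quotE; ring.
have sumq0 : 0 <= \sum_(i < size p) p`_i * taylor_quot i x y.
  apply: sumr_ge0 => i _; rewrite mulr_ge0// taylor_quot_ge0//.
    by case/andP: xs.
  by case/andP: ys.
rewrite ger0_norm; last by rewrite mulr_ge0 ?sqr_ge0.
apply: ler_wpM2l; first exact: sqr_ge0.
rewrite ler_pdivlMr// horner_coef mulr_suml; apply: ler_sum => i _.
rewrite -mulrA ler_wpM2l//; apply: le_trans (taylor_quot_bound i s0 (ltW st)).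
rewrite mulrC ler_wpM2l ?sqr_ge0// taylor_quot_le//.
by case/andP: ys => -> /= /le_trans ->//; rewrite ltW.
Qed.

Lemma cvg_poly_derive_along T (p_ : nat -> {poly R}) f x :
  (forall n k, 0 <= (p_ n)`_k) ->
  (forall y, 0 <= y < T -> (p_ n).[y] @[n --> \oo] --> f y) -> 0 <= x < T ->
  exists2 l : R, (p_ n)^`().[x] @[n --> \oo] --> l &
    (f y - f x) / (y - x) @[y --> within `[0, T[%classic x^'] --> l.
Proof.
move=> p0 pf /andP[x0 xT].
(* The points at one third and two thirds of [[x, T]] leave room for [y] to the right of [x] and a
   gap between [s] and [t]. *)
pose s := x + (T - x) / 3; pose t := x + 2 * ((T - x) / 3).
have Tx : 0 < T - x by rewrite subr_gt0.
have xs : x < s by rewrite /s; lra.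
have st : s < t by rewrite /s /t; lra.
have tT : t < T by rewrite /t; lra.
have s0 : 0 <= s by exact: le_trans x0 (ltW xs).
have t0T : 0 <= t < T by rewrite tT andbT (le_trans s0) ?ltW.
have ts0 : 0 < (t - s) ^+ 2 by rewrite exprn_gt0// subr_gt0.
have [K [_ /(_ _ (ltr_pwDr ltr01 (lexx K))) pK]] :=
  cvg_seq_bounded (cvgP (f t) (pf t t0T)).
set K1 := K + 1 in pK; have {}pK n : `|(p_ n).[t]| <= K1 by exact: pK.
pose C := K1 / (t - s) ^+ 2.
have C0 : 0 <= C by rewrite divr_ge0 ?(ltW ts0)// (le_trans _ (pK 0))// normr_ge0.
pose D n y := ((p_ n).[y] - (p_ n).[x]) / (y - x).
have Dcvg y : 0 <= y < T -> D n y @[n --> \oo] --> (f y - f x) / (y - x).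
  move=> yT; apply: cvgMl; apply: cvgB; first exact: pf.
  by apply: pf; rewrite x0.
have Dp n y : 0 <= y <= s -> y != x -> `|(p_ n)^`().[x] - D n y| <= C * `|y - x|.
  move=> ys yx; have yx0 : y - x != 0 by rewrite subr_eq0.
  have yx1 : 0 < `|y - x| by rewrite normr_gt0.
  rewrite -(ler_pM2r yx1) -normrM -mulrA -expr2 real_normK ?num_real//.
  have -> : ((p_ n)^`().[x] - D n y) * (y - x) =
      - ((p_ n).[y] - (p_ n).[x] - (p_ n)^`().[x] * (y - x)).
    by rewrite /D; field.
    rewrite normrN [leRHS]mulrC (le_trans (poly_taylor_bound (p0 n) _ ys st))//.
    by rewrite x0 ltW.
  rewrite ler_wpM2l ?sqr_ge0// ler_wpM2r ?invr_ge0 ?(ltW ts0)//.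
  exact: le_trans (ler_norm _) (pK n).
have cp : cvg ((p_ n)^`().[x] @[n --> \oo]).
  apply: cauchy_cvg; apply: cauchy_exP => e e0.
  (* At the fixed point [y = x + dy] the quotient [D n y] converges and stays within [e / 2] of the
     derivative. Dividing by [C + 1] avoids the case [C = 0]. *)
  pose dy := Num.min (s - x) (e / 2 / (C + 1)).
  have C1 : 0 < C + 1 by rewrite ltr_wpDl.
  have dy0 : 0 < dy by rewrite lt_min subr_gt0 xs/= !divr_gt0.
  have dys : dy <= s - x by rewrite /dy ge_min lexx.
  have Cdy : C * dy <= e / 2.
    rewrite (@le_trans _ _ ((C + 1) * dy))//; first by rewrite ler_wpM2r ?lerDl// ltW.
    by rewrite mulrC -ler_pdivlMr// /dy ge_min lexx orbT.
  pose y := x + dy.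
  have ys : 0 <= y <= s by rewrite /y addr_ge0 ?(ltW dy0)//=; lra.
  have yT : 0 <= y < T.
    by case/andP: ys => -> /= ys; rewrite (le_lt_trans ys)// (lt_trans st).
  have yx : y != x by rewrite /y -subr_eq0 addrAC subrr add0r gt_eqF.
  exists ((f y - f x) / (y - x)).
  have e2 : 0 < e / 2 by rewrite divr_gt0.
  have /cvgrPdist_lt/(_ _ e2) := Dcvg y yT.
  apply: filterS => n; rewrite -ball_normE /= => De.
  rewrite -(subrKA (D n y)) (le_lt_trans (ler_normD _ _))//.
  rewrite [e]splitr ltr_leD//.
  have := Dp n y ys yx; rewrite distrC => /le_trans; apply.
  by rewrite /y addrAC subrr add0r gtr0_norm.
exists (lim ((p_ n)^`().[x] @[n --> \oo])) => //.
set l := lim _.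
have lD y : 0 <= y <= s -> y != x ->
    `|l - (f y - f x) / (y - x)| <= C * `|y - x|.
  move=> ys yx.
  have yT : 0 <= y < T.
    by case/andP: ys => -> /= ys; rewrite (le_lt_trans ys)// (lt_trans st).
  have h : `|(p_ n)^`().[x] - D n y| @[n --> \oo] -->
      `|l - (f y - f x) / (y - x)|.
    by apply: cvg_norm; apply: cvgB => //; exact: Dcvg.
  rewrite -(cvg_lim _ h)//; apply: limr_le; first by apply/cvg_ex; eexists; exact: h.
  by apply: nearW => n; exact: Dp.
apply/cvgrPdist_le => e e0.
have C1 : 0 < C + 1 by rewrite ltr_wpDl.
pose dy := Num.min (s - x) (e / (C + 1)).
have dy0 : 0 < dy by rewrite lt_min subr_gt0 xs/= !divr_gt0.
rewrite /dnbhs /within /=; exists dy => //= y /ltW ydy yx.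
rewrite in_itv /= => /andP[y0 yT].
apply: le_trans (lD y _ yx) _.
  have : `|x - y| <= s - x by rewrite (le_trans ydy)// /dy ge_min lexx.
  by rewrite y0 /= ler_norml; lra.
rewrite distrC (@le_trans _ _ (C * dy))// ?ler_wpM2l//.
rewrite (@le_trans _ _ ((C + 1) * dy))//; first by rewrite ler_wpM2r ?lerDl// ltW.
by rewrite mulrC -ler_pdivlMr// /dy ge_min lexx orbT.
Qed.

(** Properness is what lets [lim] in [derive_along] be computed. Points to the right of [x] always
    remain in the interval, so [x = 0] needs no separate treatment. *)
Lemma within_itv_dnbhs_proper T x : 0 <= x < T ->
  ProperFilter (within `[0, T[%classic x^').
Proof.
move=> /andP[x0 xT]; apply: Build_ProperFilter_ex => A.
rewrite /dnbhs /within /= => -[e /= e0 xeA].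
pose d := Num.min (e / 2) ((T - x) / 2).
have d0 : 0 < d by rewrite lt_min !divr_gt0// subr_gt0.
exists (x + d); apply: xeA.
- rewrite /ball_ /= opprD addrA subrr add0r normrN gtr0_norm//.
  by rewrite /d gt_min ltr_pdivrMr// ltr_pMr// ltr1n.
- by rewrite -subr_eq0 addrAC subrr add0r gt_eqF.
- rewrite in_itv/= addr_ge0 ?(ltW d0)//=.
  have : d <= (T - x) / 2 by rewrite /d ge_min lexx orbT.
  by move: xT; lra.
Qed.

Lemma cvg_poly_absolutely_monotonic T (p_ : nat -> {poly R}) f :
  (forall n k, 0 <= (p_ n)`_k) ->
  (forall y, 0 <= y < T -> (p_ n).[y] @[n --> \oo] --> f y) ->
  absolutely_monotonic T f.
Proof.
move=> p0 pf; set I := `[0, T[%classic.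
have deriv_ge0 (q : {poly R}) : (forall k, 0 <= q`_k) -> forall k, 0 <= q^`()`_k.
  by move=> q0 k; rewrite coef_deriv mulrn_wge0.
have H m : exists2 q_ : nat -> {poly R}, (forall n k, 0 <= (q_ n)`_k) &
    forall y, 0 <= y < T ->
      (q_ n).[y] @[n --> \oo] --> derive_alongn I m f y.
  elim: m => [|m [q_ q0 qf]]; first by exists p_.
  exists (fun n => (q_ n)^`()) => [n k|y yT]; first exact: deriv_ge0.
  have [l ql fl] := cvg_poly_derive_along q0 qf yT.
  have W := within_itv_dnbhs_proper yT.
  suff -> : derive_alongn I m.+1 f y = l by [].
  by rewrite /= /derive_along; apply: cvg_lim.
split=> m x; rewrite /= in_itv /= => xT; have [q_ q0 qf] := H m.
  have [l ql fl] := cvg_poly_derive_along q0 qf xT.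
  by apply/cvg_ex; exists l.
have := qf _ xT; move=> qx; rewrite -(cvg_lim _ qx)//.
apply: limr_ge; first by apply/cvg_ex; eexists; exact: qx.
apply: nearW => n; rewrite horner_coef; apply: sumr_ge0 => i _.
by rewrite mulr_ge0// exprn_ge0//; case/andP: xT.
Qed.

End absolutely_monotonic_limits.

(** * Invariance of the Lebesgue measure *)

Section lebesgue_rV_invariance.
Context {R : realType}.

Lemma lebesgue_measure_shift (c : R) (A : set R) : measurable A ->
  lebesgue_measure ((fun a : R => a + c) @^-1` A) = lebesgue_measure A.
Proof.
move=> mA; have mT : measurable_fun setT (fun a : measurableTypeR R => a + c).
  exact: measurable_funD.
rewrite -[LHS]/(pushforward (@lebesgue_measure R)
  (fun a : measurableTypeR R => a + c : measurableTypeR R) A).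
apply/esym/lebesgue_measure_unique => //= _ [[a b]] _ <-.
rewrite /pushforward.
have -> : (fun a0 : R => a0 + c) @^-1` `]a, b]%classic = `]a - c, b - c]%classic.
  by apply/seteqP; split => x /=; rewrite !in_itv /= ltrBlDr lerBrDr.
by rewrite !lebesgue_measure_itv/= !lte_fin ltrD2r -!EFinD opprD addrACA subrr addr0.
Qed.

Lemma lebesgue_measure_isometry (s c : R) (A : set R) :
  s = 1 \/ s = -1 -> measurable A ->
  lebesgue_measure ((fun a : R => s * a + c) @^-1` A) = lebesgue_measure A.
Proof.
move=> s1 mA; case: s1 => ->.
  by under [X in X @^-1` _]funext do rewrite mul1r; exact: lebesgue_measure_shift.
rewrite -[RHS](lebesgue_measure_shift c)// -[RHS]lebesgue_measureN.
  by congr (lebesgue_measure _); apply/seteqP; split => x /=; rewrite mulN1r.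
rewrite -[X in measurable X]setTI.
have mT : measurable_fun setT (fun a : measurableTypeR R => a + c).
  exact: measurable_funD.
exact: mT.
Qed.

Lemma cons_rV_head n (a : R) (v : 'rV[R]_n) : cons_rV (a, v) ord0 ord0 = a.
Proof. by rewrite mxE unlift_none. Qed.

Lemma cons_rV_tail n (a : R) (v : 'rV[R]_n) j :
  cons_rV (a, v) ord0 (lift ord0 j) = v ord0 j.
Proof. by rewrite mxE liftK. Qed.

Lemma cons_rV_ord0 n (a c : R) (v : 'rV[R]_n) :
  cons_rV (a, v) + c *: delta_mx ord0 ord0 = cons_rV (a + c, v).
Proof.
apply/rowP => k; rewrite !mxE /=; case: (unliftP ord0 k) => [j|] -> /=.
  by rewrite mulr0 addr0.
by rewrite mulr1.
Qed.

Lemma cons_rV_lift n (a c : R) (v : 'rV[R]_n) (j : 'I_n) :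
  cons_rV (a, v) + c *: delta_mx ord0 (lift ord0 j) =
  cons_rV (a, v + c *: delta_mx ord0 j).
Proof.
apply/rowP => k; rewrite !mxE /=; case: (unliftP ord0 k) => [l|] -> /=.
  by rewrite !mxE (inj_eq lift_inj).
by rewrite mulr0 addr0.
Qed.

Lemma measurable_cons_rV_pair n (a : R) :
  measurable_fun setT (fun v : 'rV[R]_n => cons_rV (a, v)).
Proof.
exact: (measurableT_comp (@measurable_cons_rV R n) (measurable_pair1 a)).
Qed.

(** The coordinate [x_i] becomes [s * x_i + phi x]. Shears ([s = 1]) and reflections ([s = -1]) are
    both of this form; when [phi] ignores [x_i], every line parallel to axis [i] undergoes an
    isometry of the real line. *)
Definition coord_move n (i : 'I_n) (s : R) (phi : 'rV[R]_n -> R)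
    (x : 'rV[R]_n) : 'rV[R]_n :=
  x + ((s - 1) * x ord0 i + phi x) *: delta_mx ord0 i.

Lemma measurable_coord_move n (i : 'I_n) s (phi : 'rV[R]_n -> R) :
  measurable_fun setT phi -> measurable_fun setT (coord_move i s phi).
Proof.
move=> mphi; apply: measurable_fun_coordP => j.
rewrite (_ : (fun _ => _) = fun x : 'rV[R]_n => x ord0 j +
    ((s - 1) * x ord0 i + phi x) * (delta_mx ord0 i : 'rV[R]_n) ord0 j); last first.
  by apply/funext => x; rewrite !mxE.
apply: measurable_funD; first exact: measurable_coord.
apply: measurable_funM => //; apply: measurable_funD => //.
by apply: measurable_funM => //; exact: measurable_coord.
Qed.

(* Fubini, integrating first along the axis that moves. *)
Lemma lebesgue_rV_coord_move n (i : 'I_n) s (phi : 'rV[R]_n -> R)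
    (A : set 'rV[R]_n) :
  s = 1 \/ s = -1 -> measurable_fun setT phi ->
  (forall x a, phi (x + a *: delta_mx ord0 i) = phi x) -> measurable A ->
  lebesgue_rV n (coord_move i s phi @^-1` A) = lebesgue_rV n A.
Proof.
move=> s1; elim: n i phi A => [[]//|n IH] i phi A mphi phii mA.
have mB : measurable (coord_move i s phi @^-1` A).
  by rewrite -[X in measurable X]setTI; exact: measurable_coord_move.
have mc B : measurable B -> measurable (@cons_rV R n @^-1` B).
  by move=> ?; rewrite -[X in measurable X]setTI; exact: measurable_cons_rV.
rewrite /= /lebesgue_rV_step /pushforward.
case: (unliftP ord0 i) => [j|] iE.
  rewrite /product_measure1; apply: eq_integral => a _ /=.
  have -> : xsection (@cons_rV R n @^-1` (coord_move i s phi @^-1` A)) a =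
      coord_move j s (fun v => phi (cons_rV (a, v))) @^-1`
        xsection (@cons_rV R n @^-1` A) a.
    apply/seteqP; split => v; rewrite /xsection /= !inE /= /coord_move iE
      cons_rV_lift cons_rV_tail//.
  apply: IH.
  - by apply: measurableT_comp => //; exact: measurable_cons_rV_pair.
  - by move=> v c; rewrite -cons_rV_lift -iE phii.
  - by apply: measurable_xsection; exact: mc.
(* Here the head coordinate moves, and [product_measure1] integrates it last; Tonelli makes it the
   inner variable. *)
have E B : measurable B -> (@lebesgue_measure R \x lebesgue_rV n)%E B =
    (@lebesgue_measure R \x^ lebesgue_rV n)%E B.
  by apply: product_measure_unique => *; exact: product_measure2E.
rewrite !E; [|exact: mc|exact: mc].
rewrite /product_measure2; apply: eq_integral => v _ /=.
rewrite -[RHS](@lebesgue_measure_isometry s (phi (cons_rV (0, v))))//; last first.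
  by apply: measurable_ysection; exact: mc.
congr (lebesgue_measure _).
have phiE a : phi (cons_rV (a, v)) = phi (cons_rV (0, v)).
  by rewrite -[a]add0r -cons_rV_ord0 -iE phii.
apply/seteqP; split => a; rewrite /ysection /= !inE /= /coord_move iE
  cons_rV_ord0 (phiE a) cons_rV_head addrA mulrBl mul1r addrCA subrr addr0//.
Qed.

Definition box n (a b : R) : set 'rV[R]_n :=
  [set x | forall i, x ord0 i \in `[a, b]].

Lemma measurable_box n a b : measurable (box a b : set 'rV[R]_n).
Proof.
rewrite (_ : box a b = \big[setI/setT]_(i < n)
    ((fun x : 'rV[R]_n => x ord0 i) @^-1` `[a, b]%classic)); last first.
  rewrite -bigcap_seq; apply/seteqP; split => x /=.
    by move=> xab i _; exact: xab.
  by move=> xab i; apply: xab; rewrite /= mem_index_enum.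
apply: bigsetI_measurable => i _; rewrite -[X in measurable X]setTI.
exact: measurable_coord.
Qed.

(** Provides a cube inside the punctured ball and one around it, hence a sphere of positive finite
    mass. *)
Lemma lebesgue_rV_box n (a b : R) : a <= b ->
  lebesgue_rV n (box a b) = ((b - a) ^+ n)%:E.
Proof.
move=> ab; elim: n => [|n IH] /=.
  by rewrite diracE mem_set//= => -[].
rewrite /lebesgue_rV_step /pushforward.
rewrite (_ : _ @^-1` _ = `[a, b]%classic `*` box a b).
  transitivity (lebesgue_measure `[a, b]%classic * lebesgue_rV n (box a b))%E.
    by apply: product_measure1E => //; exact: measurable_box.
  rewrite IH lebesgue_measure_itv /= lte_fin.
  move: ab; rewrite le_eqVlt => /predU1P[->|ab]; last by rewrite ab -EFinD -EFinM exprS.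
  by rewrite ltxx mul0e subrr expr0n.
apply/seteqP; split => [[c v] /= H|[c v] /= [ca vb] i].
  split; first by have := H ord0; rewrite cons_rV_head.
  by move=> i; have := H (lift ord0 i); rewrite cons_rV_tail.
by rewrite /cons_rV mxE; case: unliftP => [j|] _ //=; exact: vb.
Qed.

End lebesgue_rV_invariance.

(** * Averages over spheres *)

Section sphere_isometries.
Context {R : realType} {d : nat}.
Implicit Types (x : 'rV[R]_d) (r t : R) (g : 'rV[R]_d -> 'rV[R]_d).

Lemma enorm_ge0 x : 0 <= enorm x. Proof. exact: sqrtr_ge0. Qed.

Lemma sqr_enorm x : enorm x ^+ 2 = \sum_i x ord0 i ^+ 2.
Proof. by rewrite sqr_sqrtr// sumr_ge0// => i _; rewrite sqr_ge0. Qed.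

Lemma enormZ (a : R) x : enorm (a *: x) = `|a| * enorm x.
Proof.
apply/eqP; rewrite -(@eqrXn2 _ 2)// ?mulr_ge0 ?enorm_ge0//; apply/eqP.
rewrite exprMn !sqr_enorm real_normK ?num_real// mulr_sumr.
by apply: eq_bigr => i _; rewrite mxE exprMn.
Qed.

Lemma enorm0 : enorm (0 : 'rV[R]_d) = 0.
Proof. by rewrite -(scale0r 0) enormZ normr0 mul0r. Qed.

Lemma normr_coord_enorm x i : `|x ord0 i| <= enorm x.
Proof.
rewrite -(@ler_pXn2r _ 2)// ?nnegrE ?enorm_ge0// real_normK ?num_real// sqr_enorm.
by rewrite (bigD1 i)//= lerDl sumr_ge0// => j _; rewrite sqr_ge0.
Qed.

Lemma measurable_esphere r : measurable (esphere r : set 'rV[R]_d).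
Proof.
rewrite (_ : esphere r = @enorm R d @^-1` [set r])//.
by rewrite -[X in measurable X]setTI; exact: measurable_enorm.
Qed.

(** These are the properties that the cone definition of [surface_measure] sees: preserving [enorm]
    and scaling makes [g] commute with [radial_proj], and preserving volume then transfers to
    cones. *)
Record sphere_isometry g : Prop := SphereIsometry {
  sphere_isometry_measurable : measurable_fun setT g;
  sphere_isometry_enorm : forall x, enorm (g x) = enorm x;
  sphere_isometryZ : forall (a : R) x, g (a *: x) = a *: g x;
  sphere_isometry_lebesgue : forall A, measurable A ->
    lebesgue_rV d (g @^-1` A) = lebesgue_rV d A }.

Lemma surface_measure_isometry g r E : sphere_isometry g -> measurable E ->
  surface_measure r (g @^-1` E) = surface_measure r E.
Proof.
move=> gi mE; rewrite /surface_measure; congr (_ * _)%E.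
rewrite -[RHS](sphere_isometry_lebesgue gi).
  congr (lebesgue_rV d _); apply/seteqP.
  by split=> x /=; rewrite /punctured_cball /radial_proj /=
    (sphere_isometry_enorm gi) -(sphere_isometryZ gi).
apply: measurableI; last exact: measurable_punctured_cball.
by rewrite -[X in measurable X]setTI; exact: measurable_radial_proj.
Qed.

Definition reflection (i : 'I_d) : 'rV[R]_d -> 'rV[R]_d := coord_move i (- 1) (cst 0).

Lemma reflectionE i x k : reflection i x ord0 k = if k == i then - x ord0 k else x ord0 k.
Proof.
rewrite /reflection /coord_move !mxE eqxx /=; case: eqP => [->|_] /=; last first.
  by rewrite mulr0 addr0.
by rewrite mulr1; ring.
Qed.

Lemma reflection_isometry i : sphere_isometry (reflection i).
Proof.
split.
- by apply: measurable_coord_move; exact: measurable_cst.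
- move=> x; congr Num.sqrt; apply: eq_bigr => k _.
  by rewrite reflectionE; case: ifP => //; rewrite sqrrN.
- move=> a x; apply/rowP => k; rewrite [RHS]mxE !reflectionE mxE.
  by case: ifP => //; rewrite mulrN.
- move=> A mA; apply: lebesgue_rV_coord_move => //; first by right.
Qed.

(* The rotation of angle 2 arctan t in the plane of the axes i and j. *)
Definition rotation (i j : 'I_d) t x : 'rV[R]_d :=
  \row_k if k == i then ((1 - t ^+ 2) * x ord0 i - 2 * t * x ord0 j) / (1 + t ^+ 2)
    else if k == j then (2 * t * x ord0 i + (1 - t ^+ 2) * x ord0 j) / (1 + t ^+ 2)
    else x ord0 k.

Lemma sqr_addr1_neq0 t : 1 + t ^+ 2 != 0.
Proof. by rewrite gt_eqF// ltr_pwDl// sqr_ge0. Qed.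

(** The classical factorisation of a rotation of angle [a] into shears of slopes [- tan (a / 2)],
    [sin a], [- tan (a / 2)], with [t = tan (a / 2)]. *)
Lemma rotation_shears i j t : i != j ->
  let s := 2 * t / (1 + t ^+ 2) in
  let shear k l a := coord_move k 1 (fun x => a * x ord0 l) in
  rotation i j t = shear i j (- t) \o shear j i s \o shear i j (- t).
Proof.
move=> ij s shear; apply/funext => x; apply/rowP => k /=.
have t0 := sqr_addr1_neq0 t.
rewrite /shear /coord_move !mxE !eqxx subrr !mul0r !add0r /=.
rewrite !(eq_sym j i) !(negbTE ij) /= !(mulr0, addr0, mulr1).
rewrite -[x 0 k]/(x ord0 k).
have [->|ki] := eqVneq k i; first by rewrite (negbTE ij) /s /= ?mulr1 ?mulr0 ?addr0; field.
by have [->|kj] := eqVneq k j;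
  rewrite ?(eq_sym j i) ?(negbTE ij) /= /s ?mulr1 ?mulr0 ?addr0; field.
Qed.

Lemma rotation_isometry i j t : i != j -> sphere_isometry (rotation i j t).
Proof.
move=> ij; have t0 := sqr_addr1_neq0 t.
have mphi (a : R) (k : 'I_d) : measurable_fun setT (fun x => a * x ord0 k).
  by apply: measurable_funM => //; exact: measurable_coord.
have mshear k l (a : R) :
    measurable_fun setT (coord_move k 1 (fun x => a * x ord0 l)).
  exact: measurable_coord_move.
have inv k l (a : R) A : k != l -> measurable A ->
    lebesgue_rV d (coord_move k 1 (fun x => a * x ord0 l) @^-1` A) = lebesgue_rV d A.
  move=> kl mA; apply: lebesgue_rV_coord_move => //; first by left.
  by move=> x b; rewrite !mxE eq_sym (negbTE kl) mulr0 addr0.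
have mpre (h : 'rV[R]_d -> 'rV[R]_d) A : measurable_fun setT h ->
    measurable A -> measurable (h @^-1` A).
  by move=> mh mA; rewrite -[X in measurable X]setTI; exact: mh.
split.
- rewrite rotation_shears//; apply: measurableT_comp => //.
  exact: measurableT_comp.
- move=> x; congr Num.sqrt; rewrite (bigD1 i)//= (bigD1 j) 1?eq_sym//=.
  rewrite [RHS](bigD1 i)//= [in RHS](bigD1 j) 1?eq_sym//= !addrA; congr (_ + _).
    rewrite !mxE eqxx eq_sym (negbTE ij) eqxx; field => //.
  by apply: eq_bigr => k /andP[ki kj]; rewrite mxE (negbTE ki) (negbTE kj).
- move=> a x; apply/rowP => k; rewrite !mxE.
  by case: ifP => _; [field|case: ifP => _ //; field].
- move=> A mA; rewrite rotation_shears//.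
  have ji : j != i by rewrite eq_sym.
  have mA1 := mpre _ _ (mshear i j (- t)) mA.
  have mA2 := mpre _ _ (mshear j i (2 * t / (1 + t ^+ 2))) mA1.
  by rewrite -[RHS](inv _ _ (- t) _ ij mA)
    -[RHS](inv _ _ (2 * t / (1 + t ^+ 2)) _ ji mA1) -[RHS](inv _ _ (- t) _ ij mA2).
Qed.

End sphere_isometries.

Section sphere_averages.
Context {R : realType} {d : nat}.
Hypothesis d0 : (0 < d)%N.
Variable r : R.
Hypothesis r0 : 0 < r.
Implicit Types (f h : 'rV[R]_d -> R) (x : 'rV[R]_d).

Let sigma := @surface_measure R d r.

Let mass := fine (sigma (esphere r)).

Lemma surface_measure_esphere : (0 < sigma (esphere r) < +oo)%E.
Proof.
have dr0 : 0 < d%:R / `|r| by rewrite divr_gt0 ?ltr0n// normr_gt0 gt_eqF.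
have sE : sigma (esphere r) =
    ((d%:R / `|r|)%:E * lebesgue_rV d (@punctured_cball R d r))%E.
  rewrite /sigma /surface_measure; congr (_ * lebesgue_rV d _)%E; apply/seteqP.
  split=> x /= => [[]//|xr]; split => //.
  rewrite /esphere /radial_proj /= enormZ normrM normfV.
  case/andP: xr => x0 _; rewrite (gtr0_norm r0) (gtr0_norm x0).
  by rewrite divfK// gt_eqF.
suff /andP[v0 voo] : (0 < lebesgue_rV d (@punctured_cball R d r) < +oo)%E.
  rewrite sE mule_gt0 ?lte_fin//= lte_mul_pinfty ?lee_fin ?ltW//.
have mc := @measurable_punctured_cball R d r.
apply/andP; split.
  (* The cube with sides [[r / (2 d), r / d]] fits: its points have squared norm at most
     [d (r / d)^2 <= r^2], and their positive coordinates keep them away from 0. *)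
  have rd0 : 0 < r / d%:R by rewrite divr_gt0// ltr0n.
  have h : r / d%:R / 2 <= r / d%:R by rewrite ler_pdivrMr// ler_peMr ?ler1n// ltW.
  apply: (@lt_le_trans _ _ (lebesgue_rV d (box (r / d%:R / 2) (r / d%:R)))).
    by rewrite lebesgue_rV_box// lte_fin exprn_gt0// subr_gt0 ltr_pdivrMr//
      ltr_pMr// ltr1n.
  apply: le_measure; rewrite ?inE//; first exact: measurable_box.
  move=> x xb; rewrite /punctured_cball /=; apply/andP; split.
    apply: (@lt_le_trans _ _ `|x ord0 (Ordinal d0)|); last exact: normr_coord_enorm.
    have := xb (Ordinal d0); rewrite in_itv /= => /andP[+ _].
    by move=> xl; rewrite (lt_le_trans _ (ler_norm _))// (lt_le_trans _ xl)// divr_gt0.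
  rewrite -(@ler_pXn2r _ 2)// ?nnegrE ?enorm_ge0 ?(ltW r0)// sqr_enorm.
  apply: (@le_trans _ _ (\sum_(i < d) (r / d%:R) ^+ 2)).
    apply: ler_sum => i _; have := xb i; rewrite in_itv /= => /andP[a b].
    rewrite lerXn2r// nnegrE ?(ltW rd0)// (le_trans _ a)// divr_ge0// ltW//.
  rewrite sumr_const card_ord -(mulr_natr ((r / d%:R) ^+ 2)) exprMn -mulrA ler_piMr ?sqr_ge0//.
  rewrite exprVn expr2 invfM -mulrA mulVf ?pnatr_eq0 -?lt0n// mulr1.
  by rewrite invf_le1 ?ltr0n// ler1n.
apply: (@le_lt_trans _ _ (lebesgue_rV d (box (- r) r))); last first.
  by rewrite lebesgue_rV_box ?ltey// ge0_cp// ltW.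
apply: le_measure; rewrite ?inE//; first exact: measurable_box.
move=> x /andP[_ xr] i; rewrite in_itv /= -ler_norml.
exact: le_trans (normr_coord_enorm x i) xr.
Qed.

Lemma mass_gt0 : 0 < mass.
Proof. by apply: fine_gt0; exact: surface_measure_esphere. Qed.

Definition sphere_bounded f : Prop :=
  measurable_fun (esphere r) f /\
  exists M : R, forall x, esphere r x -> `|f x| <= M.

Lemma sphere_bounded_integrable f :
  sphere_bounded f -> sigma.-integrable (esphere r) (EFin \o f).
Proof.
move=> [mf [M fM]]; apply: measurable_bounded_integrable => //.
- exact: measurable_esphere.
- by case/andP: surface_measure_esphere.
- exists M; split; first exact: num_real.
  by move=> N MN x /= xr; rewrite (le_trans (fM x xr))// ltW.
Qed.

Lemma sphere_averageE f :
  sphere_average f r = mass^-1 * \int[sigma]_(x in esphere r) f x.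
Proof. by rewrite /sphere_average gt_eqF. Qed.

Lemma sphere_average_cst (c : R) : sphere_average (fun _ : 'rV[R]_d => c) r = c.
Proof.
rewrite sphere_averageE Rintegral_cst; last exact: measurable_esphere.
by rewrite mulrCA mulVf ?mulr1// gt_eqF// mass_gt0.
Qed.

Lemma sphere_averageD f h : sphere_bounded f -> sphere_bounded h ->
  sphere_average (fun x => f x + h x) r = sphere_average f r + sphere_average h r.
Proof.
move=> bf bh; rewrite !sphere_averageE RintegralD ?mulrDr//.
- exact: measurable_esphere.
- exact: sphere_bounded_integrable.
- exact: sphere_bounded_integrable.
Qed.

Lemma sphere_averageZ (c : R) f : sphere_bounded f ->
  sphere_average (fun x => c * f x) r = c * sphere_average f r.
Proof.
move=> bf; rewrite !sphere_averageE RintegralZl 1?mulrCA//.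
- exact: measurable_esphere.
- exact: sphere_bounded_integrable.
Qed.

Lemma eq_sphere_average f h : (forall x, esphere r x -> f x = h x) ->
  sphere_average f r = sphere_average h r.
Proof.
move=> fh; rewrite !sphere_averageE; congr (_ * _).
by apply: eq_Rintegral => x; rewrite inE; exact: fh.
Qed.

Lemma sphere_average_ge0 f : (forall x, esphere r x -> 0 <= f x) ->
  0 <= sphere_average f r.
Proof.
move=> f0; rewrite sphere_averageE mulr_ge0//; last exact: Rintegral_ge0.
by rewrite invr_ge0 ltW// mass_gt0.
Qed.

Lemma sphere_bounded_cst (c : R) : sphere_bounded (fun=> c).
Proof. by split; [exact: measurable_cst|exists `|c|]. Qed.

Lemma sphere_boundedD f h : sphere_bounded f -> sphere_bounded h ->
  sphere_bounded (fun x => f x + h x).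
Proof.
move=> [mf [M fM]] [mh [N hN]]; split; first exact: measurable_funD.
by exists (M + N) => x xr; rewrite (le_trans (ler_normD _ _))// lerD// ?fM ?hN.
Qed.

Lemma sphere_boundedM f h : sphere_bounded f -> sphere_bounded h ->
  sphere_bounded (fun x => f x * h x).
Proof.
move=> [mf [M fM]] [mh [N hN]]; split; first exact: measurable_funM.
by exists (M * N) => x xr; rewrite normrM ler_pM ?fM ?hN.
Qed.

Lemma sphere_bounded_coord i : sphere_bounded (fun x => x ord0 i).
Proof.
split; first by apply: measurable_funTS; exact: measurable_coord.
by exists r => x <-; exact: normr_coord_enorm.
Qed.

Lemma sphere_average_dist f h (e : R) : sphere_bounded f -> sphere_bounded h ->
  (forall x, esphere r x -> `|f x - h x| <= e) ->
  `|sphere_average f r - sphere_average h r| <= e.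
Proof.
move=> bf bh fh.
have le1 (f1 h1 : 'rV[R]_d -> R) : sphere_bounded f1 -> sphere_bounded h1 ->
    (forall x, esphere r x -> `|f1 x - h1 x| <= e) ->
    sphere_average f1 r <= sphere_average h1 r + e.
  move=> bf1 bh1 fh1; have be := sphere_bounded_cst e.
  rewrite -(sphere_average_cst e) -sphere_averageD// !sphere_averageE.
  rewrite ler_wpM2l ?invr_ge0 ?(ltW mass_gt0)//; apply: le_Rintegral.
  - exact: measurable_esphere.
  - exact: sphere_bounded_integrable.
  - by apply: sphere_bounded_integrable; exact: sphere_boundedD.
  - by move=> x /fh1; rewrite ler_norml => /andP[_]; lra.
have := le1 _ _ bf bh fh; have := le1 _ _ bh bf; rewrite ler_norml => le2 le3.
have {}le2 := le2 (fun x xr => eq_ind _ (fun a => a <= e) (fh x xr) _ (distrC _ _)).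
lra.
Qed.

Lemma sphere_average_isometry (g : 'rV[R]_d -> 'rV[R]_d) f :
  sphere_isometry g -> measurable_fun setT f -> sphere_bounded f ->
  sphere_average (f \o g) r = sphere_average f r.
Proof.
move=> gi mf bf; rewrite !sphere_averageE; congr (_ * fine _).
have mg := sphere_isometry_measurable gi.
have gE : g @^-1` esphere r = esphere r.
  by apply/seteqP; split => x; rewrite /esphere /= (sphere_isometry_enorm gi).
rewrite -{1}gE -(integral_pushforward (f := EFin \o f) mg).
- apply: eq_measure_integral => A mA _; exact: surface_measure_isometry.
- exact/measurable_EFinP.
- rewrite gE; apply: sphere_bounded_integrable; split.
    by apply: measurable_funTS; exact: measurableT_comp.
  have [_ [M fM]] := bf; exists M => x xr; apply: fM.
  by rewrite /esphere /= (sphere_isometry_enorm gi).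
- exact: measurable_esphere.
Qed.

End sphere_averages.

(** * Harmonic polynomials *)

Section harmonic_polynomials.
Context {R : realType} {d : nat}.
Local Notation mp := (mpoly d R).
Local Notation X i := (mpolyX R (mnm1 i) : mp).
Implicit Types (p q f g h : mp) (i j : 'I_d) (k l m n : nat).

Lemma mpoly_ring_ind (P : mp -> Prop) :
  (forall c, P (mpolyC d c)) -> (forall i, P (X i)) ->
  (forall p q, P p -> P q -> P (p + q)) ->
  (forall p q, P p -> P q -> P (p * q)) -> forall p, P p.
Proof.
move=> PC PX PD PM; apply: mpolyind => [|c m p _ _ IH]; first exact: (PC 0).
apply: (PD) => //; rewrite -mul_mpolyC; apply: (PM) => //; rewrite mpolyXE_id.
apply: (big_ind P) => [||i _]; [exact: (PC 1)|exact: PM|].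
by elim: (m i) => [|n IHn]; [rewrite expr0; exact: (PC 1)|rewrite exprS; exact: PM].
Qed.

Definition homog k p : bool := p \is ishomog1 k mdeg.

Lemma homog_ind k (P : mp -> Prop) :
  P 0 -> (forall p q, P p -> P q -> P (p + q)) ->
  (forall c (m : multinom d), mdeg m = k -> P (c *: mpolyX R m)) ->
  forall p, homog k p -> P p.
Proof.
move=> P0 PD PX p /dhomogP kp; rewrite (mpolyE p) big_seq.
by apply: (big_ind P) => // m /kp; exact: PX.
Qed.

Lemma homogD k p q : homog k p -> homog k q -> homog k (p + q).
Proof. exact: dhomogD. Qed.

Lemma homogZ k c p : homog k p -> homog k (c *: p).
Proof. exact: dhomogZ. Qed.

Lemma homogM k l p q : homog k p -> homog l q -> homog (k + l) (p * q).
Proof. exact: dhomogM. Qed.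

Lemma homog0 k : homog k 0. Proof. exact: dhomog0. Qed.

Lemma homogX i : homog 1 (X i).
Proof. by rewrite /homog dhomogX /= mdeg1. Qed.

Lemma homog_sum k (F : 'I_d -> mp) :
  (forall i, homog k (F i)) -> homog k (\sum_i F i).
Proof. by move=> kF; apply: (big_ind (homog k)) => //; [exact: homog0|exact: homogD]. Qed.

Lemma mdeg_mderiv (m : multinom d) i :
  (0 < m i)%N -> mdeg (mnm_sub m (mnm1 i)) = (mdeg m).-1.
Proof.
move=> mi; have /submK <- : lem (mnm1 i) m by rewrite lep1mP -lt0n.
by rewrite mdegD mdeg1 addn1 /= addmK.
Qed.

Lemma homog_mderiv k i p : homog k p -> homog k.-1 (mderiv i p).
Proof.
move: p; apply: homog_ind.
- by rewrite mderiv0 homog0.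
- by move=> p q; rewrite mderivD; exact: homogD.
- move=> c m mk; rewrite mderivZ mderivX; apply: homogZ.
  have [->|mi] := posnP (m i); first by rewrite scale0r homog0.
  by apply: homogZ; rewrite /homog dhomogX /= mdeg_mderiv// mk.
Qed.

Lemma homog0_const p : homog 0 p -> exists c, p = mpolyC d c.
Proof.
move: p; apply: homog_ind; first by exists 0; rewrite mpolyC0.
- by move=> p q [a ->] [b ->]; exists (a + b); rewrite mpolyCD.
- move=> c m /eqP; rewrite mdeg_eq0 => /eqP ->; exists c.
  by rewrite mpolyX0 -mul_mpolyC mulr1.
Qed.

Lemma homog0_mderiv i p : homog 0 p -> mderiv i p = 0.
Proof. by move=> /homog0_const[c ->]; rewrite mderivC. Qed.

Lemma homog_euler k p : homog k p -> \sum_i X i * mderiv i p = k%:R * p.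
Proof.
move: p; apply: homog_ind.
- by rewrite mulr0 big1// => i _; rewrite mderiv0 mulr0.
- move=> p q IHp IHq; rewrite mulrDr -IHp -IHq -big_split.
  by apply: eq_bigr => i _; rewrite mderivD mulrDr.
- move=> c m mk; rewrite -scalerAr -mk mdegE natr_sum mulr_suml scaler_sumr.
  apply: eq_bigr => i _; rewrite mderivZ mderivX -!scalerAr; congr (_ *: _).
  have [->|mi] := posnP (m i); first by rewrite scale0r mul0r.
  rewrite -mpolyXD addmC submK ?lep1mP -?lt0n//.
  by rewrite -mul_mpolyC mpolyC_nat.
Qed.

Definition lap p : mp := \sum_i mderiv i (mderiv i p).
Definition grad_dot p q : mp := \sum_i mderiv i p * mderiv i q.
Definition normsq : mp := \sum_i X i ^+ 2.

Lemma lapD p q : lap (p + q) = lap p + lap q.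
Proof. by rewrite /lap -big_split; apply: eq_bigr => i _; rewrite !mderivD. Qed.

Lemma lapZ c p : lap (c *: p) = c *: lap p.
Proof. by rewrite /lap scaler_sumr; apply: eq_bigr => i _; rewrite !mderivZ. Qed.

Lemma lapB p q : lap (p - q) = lap p - lap q.
Proof. by rewrite lapD -scaleN1r lapZ scaleN1r. Qed.

Lemma lap0 : lap 0 = 0.
Proof. by rewrite /lap big1// => i _; rewrite !mderiv0. Qed.

Lemma lapM p q : lap (p * q) = lap p * q + 2 * grad_dot p q + p * lap q.
Proof.
rewrite /lap /grad_dot mulr_suml !mulr_sumr -!big_split /=; apply: eq_bigr => i _.
by rewrite !(mderivM, mderivD); ring.
Qed.

Lemma homog_lap k p : homog k p -> homog k.-2 (lap p).
Proof. by move=> kp; apply: homog_sum => i; do 2!apply: homog_mderiv. Qed.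

Lemma homog_lap_lt2 k p : (k < 2)%N -> homog k p -> lap p = 0.
Proof.
move=> k2 kp; rewrite /lap big1// => i _; apply: homog0_mderiv.
by have := homog_mderiv i kp; case: k k2 {kp} => [|[|]].
Qed.

Lemma mderiv_lap i p : lap (mderiv i p) = mderiv i (lap p).
Proof.
rewrite /lap raddf_sum; apply: eq_bigr => j _ /=.
by rewrite [mderiv j (mderiv i p)]mderiv_comm mderiv_comm.
Qed.

Lemma homog_normsq : homog 2 normsq.
Proof.
by apply: homog_sum => i; rewrite expr2; apply: (@homogM 1 1); exact: homogX.
Qed.

Lemma homog_normsqX n : homog (n * 2) (normsq ^+ n).
Proof.
elim: n => [|n IH]; first by rewrite expr0 /homog dhomog1.
by rewrite exprS mulSn; apply: homogM => //; exact: homog_normsq.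
Qed.

Lemma mderivXX i j : mderiv i (X j) = if i == j then 1 else 0.
Proof.
rewrite mderivX mnm1E eq_sym; case: eqP => [->|_]; last by rewrite scale0r.
rewrite scale1r -[RHS]mpolyX0; congr mpolyX.
by apply/mnmP => k; rewrite mnmBE subnn mnm0E.
Qed.

Lemma mderiv_normsq i : mderiv i normsq = 2 * X i.
Proof.
rewrite /normsq raddf_sum (bigD1 i)//= big1 ?addr0 => [|j ji].
  by rewrite expr2 mderivM mderivXX eqxx; ring.
by rewrite expr2 mderivM mderivXX eq_sym (negbTE ji) mulr0 mul0r addr0.
Qed.

Lemma lap_normsqM n p : homog n p ->
  lap (normsq * p) = normsq * lap p + (2 * d + 4 * n)%:R * p.
Proof.
move=> np; rewrite lapM.
have -> : lap normsq = (2 * d)%:R.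
  rewrite /lap (eq_bigr (fun=> 2)) => [|i _].
    by rewrite sumr_const card_ord -mulrnA.
  by rewrite mderiv_normsq -mpolyC_nat mderiv_mulC mderivXX eqxx mulr1 mpolyC_nat.
have -> : grad_dot normsq p = 2 * (n%:R * p).
  rewrite -(homog_euler np) mulr_sumr; apply: eq_bigr => i _.
  by rewrite mderiv_normsq mulrA.
by rewrite natrD !natrM; ring.
Qed.

(** The constant is [2 (n + 1) (d + 2 m + 2 n)]; its positivity is recorded because
    [lap_normsq_surj] divides by it. *)
Lemma lap_normsqXM n m p : homog m p -> (0 < d)%N -> exists2 c : R, 0 < c &
  lap (normsq ^+ n.+1 * p) = normsq ^+ n.+1 * lap p + c *: (normsq ^+ n * p).
Proof.
move=> mp0 d0; elim: n => [|n [c c0 IH]].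
  exists (2 * d + 4 * m)%:R; first by rewrite ltr0n addn_gt0 muln_gt0 d0.
  by rewrite expr1 (lap_normsqM mp0) expr0 mul1r -mul_mpolyC mpolyC_nat.
exists ((2 * d + 4 * (n.+1 * 2 + m))%:R + c); first by rewrite ltr_wpDl// ler0n.
rewrite exprS -mulrA (@lap_normsqM (n.+1 * 2 + m)); last first.
  by apply: homogM => //; exact: homog_normsqX.
rewrite IH scalerDl -!mul_mpolyC mpolyC_nat !exprS; ring.
Qed.

(** The first guess for [q] is a multiple of [normsq ^+ n * p]. Its error is a multiple of
    [normsq ^+ n.+1 * lap p], a right-hand side of the same shape with [m] lowered by 2; this is why
    the power [n] is carried along. The recursion takes the place of the inner-product and dimension
    count usual for Fischer's decomposition. *)
Lemma lap_normsq_surj m n p : (0 < d)%N -> homog m p ->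
  exists2 q, homog (n * 2 + m) q & lap (normsq * q) = normsq ^+ n * p.
Proof.
move=> d0; elim/ltn_ind: m n p => m IH n p mp0.
have [c c0 E] := lap_normsqXM n mp0 d0.
have hp : homog (n * 2 + m) (normsq ^+ n * p).
  by apply: homogM => //; exact: homog_normsqX.
have cE q : lap (normsq * q) = normsq ^+ n.+1 * lap p ->
    lap (normsq * (c^-1 *: (normsq ^+ n * p - q))) = normsq ^+ n * p.
  move=> qE; rewrite -scalerAr lapZ mulrBr lapB mulrA -exprS E qE addrAC subrr.
  by rewrite add0r scalerA mulVf ?scale1r// gt_eqF.
have [m2|m2] := ltnP m 2.
  exists (c^-1 *: (normsq ^+ n * p - 0)); first by rewrite subr0; exact: homogZ.
  by apply: cE; rewrite (homog_lap_lt2 m2 mp0) !mulr0 lap0.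
have m2m : (m.-2 < m)%N by case: m m2 {IH mp0 E hp} => [|[|m]].
have [q qh qE] := IH _ m2m n.+1 _ (homog_lap mp0).
exists (c^-1 *: (normsq ^+ n * p - q)); last exact: cE.
apply: homogZ; apply: homogD => //; rewrite -scaleN1r; apply: homogZ.
by move: qh; congr (homog _ q); case: m m2 {IH mp0 E hp m2m qE} => [|[|m]]//= _; lia.
Qed.

Definition peval p (x : 'rV[R]_d) : R := meval (fun i => x ord0 i) p.

Lemma pevalD p q x : peval (p + q) x = peval p x + peval q x.
Proof. exact: mevalD. Qed.

Lemma pevalM p q x : peval (p * q) x = peval p x * peval q x.
Proof. exact: mevalM. Qed.

Lemma pevalZ c p x : peval (c *: p) x = c * peval p x.
Proof. exact: mevalZ. Qed.

Lemma pevalB p q x : peval (p - q) x = peval p x - peval q x.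
Proof. exact: mevalB. Qed.

Lemma pevalC c x : peval (mpolyC d c) x = c.
Proof. exact: mevalC. Qed.

Lemma pevalX i x : peval (X i) x = x ord0 i.
Proof. exact: mevalXU. Qed.

Lemma peval_sum (I : Type) (s : seq I) (F : I -> mp) x :
  peval (\sum_(i <- s) F i) x = \sum_(i <- s) peval (F i) x.
Proof. by rewrite /peval raddf_sum. Qed.

Lemma peval_normsq x : peval normsq x = enorm x ^+ 2.
Proof.
rewrite sqr_enorm /normsq peval_sum; apply: eq_bigr => i _.
by rewrite expr2 pevalM pevalX.
Qed.

(* The Fischer decomposition [p = h + |x|^2 q] lowers the degree by 2, and
   [|x|^2] is constant on the sphere. *)
Lemma homog_dirichlet k p (r : R) : (0 < d)%N -> homog k p ->
  exists2 h, lap h = 0 & forall x, enorm x = r -> peval h x = peval p x.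
Proof.
move=> d0; elim/ltn_ind: k p => k IH p kp.
have [k2|k2] := ltnP k 2; first by exists p => //; exact: homog_lap_lt2 k2 kp.
have [q qh qE] := lap_normsq_surj 0 d0 (homog_lap kp).
rewrite mul0n add0n in qh; rewrite expr0 mul1r in qE.
have k2k : (k.-2 < k)%N by case: k k2 {IH kp qh} => [|[|m]].
have [h hl hq] := IH _ k2k q qh.
exists (p - normsq * q + r ^+ 2 *: h).
  by rewrite lapD lapB lapZ hl qE subrr scaler0 addr0.
move=> x xr; rewrite pevalD pevalB pevalM pevalZ peval_normsq xr hq//.
by rewrite subrK.
Qed.

Lemma mpoly_dirichlet p (r : R) : (0 < d)%N ->
  exists2 h, lap h = 0 & forall x, enorm x = r -> peval h x = peval p x.
Proof.
move=> d0; rewrite (pihomog_partitionE (leqnn (mmeasure mdeg p))).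
apply: (big_ind (fun p => exists2 h, lap h = 0 &
    forall x, enorm x = r -> peval h x = peval p x))
  => [|p1 p2 [h1 l1 e1] [h2 l2 e2]|i _].
- by exists 0 => //; exact: lap0.
- exists (h1 + h2); first by rewrite lapD l1 l2 addr0.
  by move=> x xr; rewrite !pevalD e1// e2.
- by apply: (@homog_dirichlet i) => //; exact: pihomogP.
Qed.

Lemma mderiv_pihomog i k p :
  mderiv i (pihomog mdeg k.+1 p) = pihomog mdeg k (mderiv i p).
Proof.
elim/mpolyind: p => [|c m p _ _ IH]; first by rewrite !(pihomog0, mderiv0).
rewrite pihomogD !mderivD pihomogD IH; congr (_ + _).
rewrite linearZ /= !mderivZ linearZ /=; congr (_ *: _).
rewrite pihomogX mderivX linearZ /= pihomogX.
have [mi|mi] := posnP (m i).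
  by rewrite mi scale0r; case: ifP; rewrite ?mderiv0// mderivX mi scale0r.
rewrite /= mdeg_mderiv//; have : (0 < mdeg m)%N.
  by rewrite mdegE (bigD1 i)//= addn_gt0 mi.
case: (mdeg m) => // e _ /=; rewrite eqSS; case: ifP => _.
  by rewrite mderivX.
by rewrite mderiv0 scaler0.
Qed.

(** The Laplacian lowers degrees by exactly 2, so it sends the component of degree [k + 2] to the
    component of degree [k] of [lap p]; degrees 0 and 1 are killed outright. *)
Lemma lap_pihomog k p : lap p = 0 -> lap (pihomog mdeg k p) = 0.
Proof.
move=> lp; case: k => [|[|k]].
- by apply: (@homog_lap_lt2 0) => //; exact: pihomogP.
- by apply: (@homog_lap_lt2 1) => //; exact: pihomogP.
- transitivity (pihomog mdeg k (lap p)); last by rewrite lp pihomog0.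
  rewrite /lap raddf_sum; apply: eq_bigr => i _ /=.
  by rewrite !mderiv_pihomog.
Qed.

End harmonic_polynomials.

(** * Averages of polynomials *)

Section averages_of_polynomials.
Context {R : realType} {d : nat}.
Hypothesis d0 : (0 < d)%N.
Local Notation mp := (mpoly d R).
Local Notation X i := (mpolyX R (mnm1 i) : mp).
Implicit Types (p q f h : mp) (i j : 'I_d) (k l m n : nat) (r t : R).

Let eqW (a b : R) : a = b -> a <= b. Proof. by move->. Qed.

Definition poly_average r p : R := sphere_average (peval p) r.

Lemma sphere_bounded_peval r p : sphere_bounded r (peval p).
Proof.
move: p; apply: mpoly_ring_ind.
- move=> c; rewrite (_ : peval _ = fun=> c); first exact: sphere_bounded_cst.
  by apply/funext => x; rewrite pevalC.
- move=> i; rewrite (_ : peval _ = fun x => x ord0 i).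
    exact: sphere_bounded_coord.
  by apply/funext => x; rewrite pevalX.
- move=> p q bp bq; rewrite (_ : peval _ = fun x => peval p x + peval q x).
    exact: sphere_boundedD.
  by apply/funext => x; rewrite pevalD.
- move=> p q bp bq; rewrite (_ : peval _ = fun x => peval p x * peval q x).
    exact: sphere_boundedM.
  by apply/funext => x; rewrite pevalM.
Qed.

Lemma measurable_peval p : measurable_fun setT (peval p).
Proof.
move: p; apply: mpoly_ring_ind.
- move=> c; rewrite (_ : peval _ = fun=> c); first exact: measurable_cst.
  by apply/funext => x; rewrite pevalC.
- move=> i; rewrite (_ : peval _ = fun x => x ord0 i).
    exact: measurable_coord.
  by apply/funext => x; rewrite pevalX.
- move=> p q bp bq; rewrite (_ : peval _ = fun x => peval p x + peval q x).
    exact: measurable_funD.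
  by apply/funext => x; rewrite pevalD.
- move=> p q bp bq; rewrite (_ : peval _ = fun x => peval p x * peval q x).
    exact: measurable_funM.
  by apply/funext => x; rewrite pevalM.
Qed.

(** Half the derivative at [t = 0] of [p] along [rotation i j t], whose angle [2 arctan t] accounts
    for the factor 2 in [rotation_taylor]. *)
Definition rot_gen i j p : mp := X i * mderiv j p - X j * mderiv i p.

Lemma rot_genM i j p q : rot_gen i j (p * q) = rot_gen i j p * q + p * rot_gen i j q.
Proof. by rewrite /rot_gen !mderivM; ring. Qed.

Lemma rot_genD i j p q : rot_gen i j (p + q) = rot_gen i j p + rot_gen i j q.
Proof. by rewrite /rot_gen !mderivD; ring. Qed.

(** A remainder uniform on the sphere can be averaged directly. Such an expansion is stable under
    sums and products because [rot_gen] is a derivation, so only the coordinates require a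
    computation. *)
Lemma rotation_taylor i j p r : i != j -> exists C : R, forall t x,
  `|t| <= 1 -> enorm x = r ->
  `|peval p (rotation i j t x) - peval p x - 2 * t * peval (rot_gen i j p) x|
    <= C * t ^+ 2.
Proof.
move=> ij; have ji : j != i by rewrite eq_sym.
move: p; apply: mpoly_ring_ind.
- move=> c; exists 0 => t x _ _; rewrite /rot_gen !mderivC !mulr0 subrr.
  by rewrite !pevalC subrr mulr0 subr0 normr0 mul0r.
- move=> k; exists (4 * r) => t x t1 xr.
  have r0 : 0 <= r by rewrite -xr enorm_ge0.
  have t0 := sqr_addr1_neq0 t.
  have tt0 : 0 <= t ^+ 2 by exact: sqr_ge0.
  have tt2 : 0 <= 2 * t ^+ 2 by rewrite mulr_ge0.
  (* The fraction is the exact remainder for a moved coordinate; [|t * b - a| <= 2 * r] yields the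
     constant [4 * r]. *)
  have key (a b : R) : `|a| <= r -> `|b| <= r ->
      `|(2 * t ^+ 2 * (t * b - a)) / (1 + t ^+ 2)| <= 4 * r * t ^+ 2.
    move=> ar br; rewrite normrM normfV (ger0_norm (addr_ge0 ler01 tt0)).
    rewrite ler_pdivrMr ?ltr_pwDl// normrM (ger0_norm tt2).
    have tb : `|t * b - a| <= 2 * r.
      rewrite (le_trans (ler_normB _ _))// normrM.
      have : `|t| * `|b| <= 1 * r by exact: ler_pM.
      by move: ar; lra.
    have -> : 4 * r * t ^+ 2 * (1 + t ^+ 2) =
      2 * t ^+ 2 * (2 * r) + 4 * r * (t ^+ 2 * t ^+ 2) by ring.
    apply: ler_wpDr; first by apply: mulr_ge0; apply: mulr_ge0.
    exact: ler_wpM2l tb.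
  rewrite /rot_gen !mderivXX pevalB !pevalM !pevalX mxE.
  have xk (l : 'I_d) : `|x ord0 l| <= r by rewrite -xr normr_coord_enorm.
  have p1 : peval (1 : mp) x = 1 by exact: pevalC.
  have p0 : peval (0 : mp) x = 0 by exact: meval0.
  have [->|ki] := eqVneq k i.
    rewrite ?eqxx ?(negbTE ji) ?(negbTE ij) p0 p1.
    apply: le_trans (key (x ord0 i) (x ord0 j) _ _) => //.
    by apply: eqW; congr `|_|; field.
  have [->|kj] := eqVneq k j.
    rewrite ?eqxx ?(negbTE ij) ?(negbTE ji) p0 p1.
    apply: le_trans (key (x ord0 j) (- x ord0 i) _ _) => //; last by rewrite normrN.
    by apply: eqW; congr `|_|; field.
  by rewrite /= !p0 !(mulr0, subrr, subr0) normr0; apply: mulr_ge0 => //; exact: mulr_ge0.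
- move=> p q [C Cp] [D Dq]; exists (C + D) => t x t1 xr.
  rewrite rot_genD (pevalD p) (pevalD p) (pevalD (rot_gen i j p)) [leRHS]mulrDl.
  apply: (le_trans _ (lerD (Cp t x t1 xr) (Dq t x t1 xr))).
  apply: (le_trans _ (ler_normD _ _)); apply: eqW; congr `|_|; ring.
- move=> p q [C Cp] [D Dq].
  have [_ [M1 pM]] := sphere_bounded_peval r p.
  have [_ [M2 qM]] := sphere_bounded_peval r q.
  have [_ [M3 LpM]] := sphere_bounded_peval r (rot_gen i j p).
  have [_ [M4 LqM]] := sphere_bounded_peval r (rot_gen i j q).
  (* The three terms bound the remainder of [q] times the rotated [p], the remainder of [p] times
     the first-order expansion of [q], and the product of the two first-order terms, which is
     already of order [t ^+ 2]. *)
  exists (M1 * D + C * (M2 + 2 * M4) + 4 * (M3 * M4)) => t x t1 xr.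
  have gr : enorm (rotation i j t x) = r.
    by rewrite (sphere_isometry_enorm (rotation_isometry t ij)).
  have {}Cp := Cp t x t1 xr; have {}Dq := Dq t x t1 xr.
  set e := _ - _ - _ in Cp; set e' := _ - _ - _ in Dq.
  rewrite rot_genM pevalD (pevalM p) (pevalM p) (pevalM p) (pevalM (rot_gen i j p)).
  have -> : peval p (rotation i j t x) * peval q (rotation i j t x) -
      peval p x * peval q x - 2 * t * (peval (rot_gen i j p) x * peval q x +
        peval p x * peval (rot_gen i j q) x) =
      peval p (rotation i j t x) * e' +
      e * (peval q x + 2 * t * peval (rot_gen i j q) x) +
      4 * t ^+ 2 * (peval (rot_gen i j p) x * peval (rot_gen i j q) x).
    by rewrite /e /e'; ring.
  have -> : (M1 * D + C * (M2 + 2 * M4) + 4 * (M3 * M4)) * t ^+ 2 =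
      M1 * (D * t ^+ 2) + C * t ^+ 2 * (M2 + 2 * M4) + 4 * t ^+ 2 * (M3 * M4).
    by ring.
  apply: (le_trans (ler_normD _ _)); apply: lerD.
    apply: (le_trans (ler_normD _ _)); apply: lerD.
      by rewrite normrM; apply: ler_pM => //; exact: pM.
    rewrite normrM; apply: ler_pM => //.
    apply: (le_trans (ler_normD _ _)); apply: lerD; first exact: qM.
    rewrite normrM; apply: ler_pM => //; last exact: LqM.
    by rewrite normrM ger0_norm// ler_piMr.
  rewrite normrM normrM (ger0_norm (sqr_ge0 t)) ger0_norm//.
  apply: ler_wpM2l; first by apply: mulr_ge0 => //; exact: sqr_ge0.
  by rewrite normrM; apply: ler_pM => //; [exact: LpM|exact: LqM].
Qed.

Section fixed_radius.
Variable r : R.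
Hypothesis r0 : 0 < r.
Local Notation A := (poly_average r).

Lemma poly_averageD p q : A (p + q) = A p + A q.
Proof.
rewrite /poly_average -sphere_averageD//; try exact: sphere_bounded_peval.
by congr (sphere_average _ r); apply/funext => x; rewrite pevalD.
Qed.

Lemma poly_averageZ c p : A (c *: p) = c * A p.
Proof.
rewrite /poly_average -sphere_averageZ//; last exact: sphere_bounded_peval.
by congr (sphere_average _ r); apply/funext => x; rewrite pevalZ.
Qed.

Lemma poly_averageC c : A (mpolyC d c) = c.
Proof.
rewrite -[RHS](sphere_average_cst d0 r0 c); congr (sphere_average _ r).
by apply/funext => x; rewrite pevalC.
Qed.

Lemma poly_average0 : A 0 = 0.
Proof. by rewrite -(mpolyC0 d R) poly_averageC. Qed.

Lemma poly_average_natM n p : A (n%:R * p) = n%:R * A p.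
Proof. by rewrite -mpolyC_nat mul_mpolyC poly_averageZ. Qed.

Lemma poly_average_sum (I : Type) (s : seq I) (F : I -> mp) :
  A (\sum_(i <- s) F i) = \sum_(i <- s) A (F i).
Proof.
by elim/big_rec2: _ => [|i x y _ <-]; [exact: poly_average0|exact: poly_averageD].
Qed.

Lemma poly_average_normsqM p : A (normsq * p) = r ^+ 2 * A p.
Proof.
rewrite -poly_averageZ; apply: eq_sphere_average => // x xr.
by rewrite pevalM pevalZ peval_normsq xr.
Qed.

Lemma poly_average_sqr_ge0 p : 0 <= A (p * p).
Proof. by apply: sphere_average_ge0 => // x _; rewrite pevalM -expr2 sqr_ge0. Qed.

(** Rotating does not change the average, so the first-order term [2 * t * A (rot_gen i j p)] is
    bounded by a multiple of [t ^+ 2]; divide by [t] and let it tend to 0. *)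
Lemma poly_average_rot_gen i j p : A (rot_gen i j p) = 0.
Proof.
have [->|ij] := eqVneq i j; first by rewrite /rot_gen subrr poly_average0.
have [C Cp] := rotation_taylor p r ij.
have bound t : 0 < t -> t <= 1 -> `|A (rot_gen i j p)| <= `|C| / 2 * t.
  move=> t0 t1; have tn : `|t| <= 1 by rewrite gtr0_norm.
  have gi := rotation_isometry (R := R) t ij.
  have bp := sphere_bounded_peval r p.
  have mp_ := measurable_peval p.
  have := sphere_average_dist d0 r0 (f := peval p \o rotation i j t)
    (h := peval (p + (2 * t) *: rot_gen i j p)) (e := C * t ^+ 2).
  rewrite sphere_average_isometry// -/(poly_average r _) -/(poly_average r _).
  rewrite poly_averageD poly_averageZ opprD addNKr normrN !normrM.
  rewrite ger0_norm// (gtr0_norm t0) => h.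
  have {h} : 2 * t * `|A (rot_gen i j p)| <= C * t ^+ 2.
    apply: h; last 2 first.
    - exact: sphere_bounded_peval.
    - move=> x xr; apply: (le_trans _ (Cp t x tn xr)); apply: eqW; congr `|_|.
      by rewrite /= pevalD pevalZ; ring.
    split; first by apply: measurable_funTS; apply: measurableT_comp => //;
      exact: sphere_isometry_measurable gi.
    have [_ [M pM]] := bp; exists M => x xr; apply: pM.
    by rewrite /esphere /= (sphere_isometry_enorm gi).
  have := ler_norm C; move=> CC h.
  have t20 : 0 < 2 * t by rewrite mulr_gt0.
  rewrite -(ler_pM2l t20) (le_trans h)//.
  have -> : 2 * t * (`|C| / 2 * t) = `|C| * t ^+ 2 by field.
  by rewrite ler_wpM2r ?sqr_ge0.
apply/eqP; rewrite -normr_le0; apply/ler_addgt0Pl => e e0; rewrite addr0.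
have C1 : 0 < `|C| / 2 + 1 by rewrite ltr_wpDl// divr_ge0.
pose t := Num.min 1 (e / (`|C| / 2 + 1)).
have t0 : 0 < t by rewrite lt_min ltr01 divr_gt0.
have t1 : t <= 1 by rewrite ge_min lexx.
apply: le_trans (bound t t0 t1) _; rewrite (@le_trans _ _ ((`|C| / 2 + 1) * t))//.
  by rewrite ler_wpM2r ?lerDl// ltW.
by rewrite mulrC -ler_pdivlMr// ge_min lexx orbT.
Qed.

(** The double sum has average 0. The arguments [X i * mderiv j p] are chosen so that Euler's
    identity, for [p] and for its derivatives, collapses everything except [normsq * lap p] to
    multiples of [p]. Negative terms are moved to the left to keep natural coefficients. *)
Lemma sum_rot_gen m p : homog m p ->
  \sum_i \sum_j rot_gen i j (X i * mderiv j p) + (d * m + m.-1 * m)%:R * p =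
  normsq * lap p + m%:R * p.
Proof.
move=> mp0.
have euler2 : \sum_i \sum_j X j * (X i * mderiv i (mderiv j p)) =
    (m.-1 * m)%:R * p.
  rewrite exchange_big natrM -mulrA -(homog_euler mp0) mulr_sumr /=.
  apply: eq_bigr => j _; rewrite -mulr_sumr mulrCA; congr (_ * _).
  exact/homog_euler/homog_mderiv.
have euler1 : \sum_(i < d) \sum_j X j * mderiv j p = (d * m)%:R * p.
  under eq_bigr do rewrite (homog_euler mp0).
  by rewrite sumr_const card_ord -[LHS]mulr_natl natrM mulrA.
have sq : \sum_i \sum_j X i ^+ 2 * mderiv j (mderiv j p) = normsq * lap p.
  by rewrite mulr_suml; apply: eq_bigr => i _; rewrite mulr_sumr.
have diag : \sum_i \sum_j X i * mderiv j (X i) * mderiv j p = m%:R * p.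
  rewrite -(homog_euler mp0); apply: eq_bigr => i _.
  rewrite (bigD1 i)//= big1 => [|j ji]; last first.
    by rewrite mderivXX (negbTE ji) mulr0 mul0r.
  by rewrite mderivXX eqxx mulr1 addr0.
rewrite natrD mulrDl -euler2 -euler1 -sq -diag -!big_split /=.
apply: eq_bigr => i _; rewrite -!big_split; apply: eq_bigr => j _ /=.
have XE : mderiv i (X i) = 1 by rewrite mderivXX eqxx.
by rewrite /rot_gen !mderivM XE; ring.
Qed.

Lemma poly_average_lap m p : homog m p ->
  (d * m + m.-1 * m)%:R * A p = r ^+ 2 * A (lap p) + m%:R * A p.
Proof.
move=> mp0; have := congr1 A (sum_rot_gen mp0).
rewrite !poly_averageD poly_average_normsqM !poly_average_natM.
rewrite poly_average_sum big1 ?add0r// => i _.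
by rewrite poly_average_sum big1// => j _; exact: poly_average_rot_gen.
Qed.

(** For [d = 1] there are no rotations, and [poly_average_lap] is void in degree 1; a reflection
    covers every dimension. *)
Lemma poly_averageX i : A (X i) = 0.
Proof.
have mX : measurable_fun setT (peval (X i)) by exact: measurable_peval.
have := sphere_average_isometry d0 r0 (reflection_isometry i) mX
  (sphere_bounded_peval r (X i)).
have -> : sphere_average (peval (X i) \o reflection i) r = A (- 1 *: X i).
  congr (sphere_average _ r); apply/funext => x /=.
  by rewrite pevalZ !pevalX reflectionE eqxx mulN1r.
rewrite poly_averageZ -/(poly_average r _); lra.
Qed.

Lemma poly_average_homog1 p : homog 1 p -> A p = 0.
Proof.
move=> hp; rewrite -[p]mul1r -(homog_euler hp) poly_average_sum big1// => i _.
have /homog0_const[c ->] := homog_mderiv i hp.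
by rewrite mulrC mul_mpolyC poly_averageZ poly_averageX mulr0.
Qed.

End fixed_radius.

(* [m (m + d - 2)], rearranged because [d - 2] truncates when [d = 1]. *)
Definition lap_coef m : R := (d * m + m.-1 * m)%:R - m%:R.

Lemma lap_coef_gt0 m : (1 < m)%N -> 0 < lap_coef m.
Proof. by move=> m1; rewrite subr_gt0 ltr_nat; case: m m1 => [|[|m]]//= _; nia. Qed.

(** Partial derivatives of harmonic polynomials are harmonic, so each step lowers both degrees by 1
    until one factor is constant. If the other still has positive degree, its average is 0;
    otherwise both are constants. Orthogonality and the dependence on [r] thus come out of one
    induction. *)
Lemma poly_average_harmonic k l f h (r : R) : 0 < r ->
  homog k f -> lap f = 0 -> homog l h -> lap h = 0 ->
  poly_average r (f * h) =
  if k == l then r ^+ k.*2 * poly_average 1 (f * h) else 0.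
Proof.
move=> r0; elim: k l f h => [|k IH] l f h kf lf lh lph.
  have [c ->] := homog0_const kf; rewrite mul_mpolyC !poly_averageZ//.
  case: l lh => [|[|l]] lh /=.
  - by have [e ->] := homog0_const lh; rewrite !poly_averageC// expr0 mul1r.
  - by rewrite poly_average_homog1// mulr0.
  - have /eqP := poly_average_lap r0 lh; rewrite lph poly_average0// mulr0 add0r.
    rewrite -subr_eq0 -mulrBl mulf_eq0 -/(lap_coef _) gt_eqF ?lap_coef_gt0//=.
    by move=> /eqP ->; rewrite mulr0.
case: l lh => [|l] lh.
  have [c ->] := homog0_const lh; rewrite mulrC mul_mpolyC !poly_averageZ//=.
  case: k kf {IH} => [|k] kf; first by rewrite poly_average_homog1// mulr0.
  have /eqP := poly_average_lap r0 kf; rewrite lf poly_average0// mulr0 add0r.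
  rewrite -subr_eq0 -mulrBl mulf_eq0 -/(lap_coef _) gt_eqF ?lap_coef_gt0//=.
  by move=> /eqP ->; rewrite mulr0.
have m2 : (1 < k.+1 + l.+1)%N by rewrite addSn addnS.
have c0 := lap_coef_gt0 m2.
(* Used at the radii [r] and 1, so that the common factor [lap_coef] cancels. *)
have E (s : R) : 0 < s -> lap_coef (k.+1 + l.+1) * poly_average s (f * h) =
    s ^+ 2 * (2 * \sum_i poly_average s (mderiv i f * mderiv i h)).
  move=> s0; have := poly_average_lap s0 (homogM kf lh).
  rewrite lapM lf lph mul0r mulr0 addr0 add0r poly_average_natM//.
  by rewrite /grad_dot poly_average_sum// /lap_coef mulrBl => ->; rewrite addrK.
have {}IH i : poly_average r (mderiv i f * mderiv i h) =
    if k == l then r ^+ k.*2 * poly_average 1 (mderiv i f * mderiv i h) else 0.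
  apply: IH; [exact: homog_mderiv kf| |exact: homog_mderiv lh|].
    by rewrite mderiv_lap lf mderiv0.
  by rewrite mderiv_lap lph mderiv0.
apply: (mulfI (lt0r_neq0 c0)); rewrite E//; under eq_bigr do rewrite IH.
rewrite eqSS; case: eqP => _; last by rewrite big1 ?mulr0.
rewrite -mulr_sumr mulrCA [RHS]mulrCA E// expr1n mul1r doubleS !exprS !mulrA.
by congr (_ * _); ring.
Qed.

Lemma poly_average_sqr_harmonic h : lap h = 0 ->
  exists2 P : {poly R}, (forall k, 0 <= P`_k) &
    forall r, 0 <= r -> sphere_average (fun x => peval h x ^+ 2) r = P.[r].
Proof.
move=> lh; pose N := mmeasure mdeg h; pose H k := pihomog mdeg k h.
have hE : h = \sum_(k < N) H k by exact: pihomog_partitionE.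
have Hh k : homog k (H k) by exact: pihomogP.
have lH k : lap (H k) = 0 by exact: lap_pihomog.
pose a k := poly_average 1 (H k * H k).
exists (\sum_(k < N) a k *: 'X^(k.*2)) => [k|r].
  rewrite coef_sum sumr_ge0// => i _; rewrite coefZ coefXn mulr_ge0//.
  exact: poly_average_sqr_ge0.
rewrite le_eqVlt => /predU1P[<-|r0]; last first.
  transitivity (poly_average r (h * h)).
    by congr (sphere_average _ r); apply/funext => x; rewrite pevalM.
  rewrite {1}hE mulr_suml poly_average_sum// horner_sum; apply: eq_bigr => k _.
  rewrite hE mulr_sumr poly_average_sum// (bigD1 k)//= big1 ?addr0; last first.
    move=> l lk; rewrite (poly_average_harmonic r0 (Hh k) _ (Hh l))//.
    by case: eqP => // kl; rewrite -(inj_eq val_inj) /= kl eqxx in lk.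
  by rewrite (poly_average_harmonic r0 (Hh k) _ (Hh k))// eqxx hornerZ hornerXn mulrC.
(* At radius 0 the average is [peval h 0 ^+ 2] by convention. Components of positive degree vanish
   there by Euler's identity, which leaves the constant coefficient. *)
rewrite /sphere_average eqxx horner_sum hE peval_sum.
have H0 k : peval (H k.+1) 0 = 0.
  have : k.+1%:R * peval (H k.+1) 0 = 0.
    rewrite -(pevalC k.+1%:R (0 : 'rV[R]_d)) mpolyC_nat -pevalM -(homog_euler (Hh _)) peval_sum.
    by rewrite big1// => i _; rewrite pevalM pevalX mxE mul0r.
  by move=> /eqP; rewrite mulf_eq0 pnatr_eq0 => /eqP.
move: {hE}(N) => [|M]; first by rewrite !big_ord0 expr0n.
rewrite !big_ord_recl /= !big1 ?addr0.
- have [c cE] := homog0_const (Hh 0%N).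
  rewrite /a cE pevalC hornerZ hornerXn mulr1 -mpolyCM poly_averageC//.
- by move=> i _; rewrite hornerZ hornerXn /= doubleS exprS mul0r mulr0.
- by move=> i _; exact: H0.
Qed.

End averages_of_polynomials.

(** * The maximum principle *)

(** If [c > 0], then [g], which vanishes at the maximum, is positive just to the right of 0, and the
    mean value theorem makes [f] exceed [f 0]. *)
Lemma local_max_second_derivative {R : realType} (f g : R -> R) (e c : R) :
  0 < e -> (forall t : R, `|t| < e -> is_derive t 1 f (g t)) ->
  is_derive (0 : R) 1 g c -> (forall t, `|t| < e -> f t <= f 0) -> c <= 0.
Proof.
move=> e0 fg gc fmax; rewrite leNgt; apply/negP => c0.
have g0 : g 0 = 0.
  have in_e t : t \in `]- e, e[ -> `|t| < e by rewrite in_itv /= ltr_norml.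
  have ee : 0 \in `]- e, e[ by rewrite in_itv /= oppr_lt0 e0.
  have := @derive1_at_max R f (- e) e 0 _ _ ee _.
  move=> /(_ (ltW (gtrN e0)))[].
  - by move=> t /in_e /fg [].
  - by move=> t /in_e /fmax.
  - by move=> _ D0; have [|_ <-] := fg 0; rewrite ?normr0.
have [/cvg_ex[l gl] gE] := gc.
have lc : l = c by rewrite -gE; apply/esym/cvg_lim.
have := cvgr_gt _ gl 0; rewrite lc => /(_ _ c0).
rewrite /dnbhs /within /= => -[del /= del0 gpos].
pose t := Num.min (e / 2) (del / 2).
have t0 : 0 < t by rewrite lt_min !divr_gt0.
have te : t < e.
  by rewrite (@le_lt_trans _ _ (e / 2))// ?ge_min ?lexx// ltr_pdivrMr// ltr_pMr// ltr1n.
have tdel : t < del.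
  rewrite (@le_lt_trans _ _ (del / 2))// ?ge_min ?lexx ?orbT//.
  by rewrite ltr_pdivrMr// ltr_pMr// ltr1n.
have [s||s st] := @MVT R f g 0 t t0.
- by rewrite in_itv /= => /andP[s0 st]; apply: fg; rewrite gtr0_norm// (lt_trans st).
- apply: derivable_within_continuous => s; rewrite in_itv /= => /andP[s0 st].
  by have [] := fg s _; rewrite ?ger0_norm// (le_lt_trans st).
move: st; rewrite in_itv /= => /andP[s0 st] E.
have gs : 0 < g s.
  have := gpos s; rewrite /ball_ /= sub0r normrN gtr0_norm// => /(_ (lt_trans st tdel)).
  rewrite gt_eqF// => /(_ isT).
  rewrite /shift /= [s%:A]mulr1 addr0 g0 subr0 => h.
  by rewrite -(pmulr_rgt0 _ (_ : 0 < s^-1)) ?invr_gt0.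
have : 0 < f t - f 0 by rewrite E subr0 mulr_gt0.
by rewrite subr_gt0 ltNge fmax// gtr0_norm.
Qed.

Section maximum_principle.
Context {R : realType} {d : nat}.
Local Notation mp := (mpoly d R).
Local Notation X i := (mpolyX R (mnm1 i) : mp).
Local Notation e_ i := (delta_mx ord0 i : 'rV[R]_d).
Implicit Types (p q h : mp) (i j : 'I_d) (x y : 'rV[R]_d) (u : 'rV[R]_d -> R).

Lemma is_derive_peval_line p i x t :
  is_derive t (1 : R) (fun s => peval p (x + s *: e_ i))
    (peval (mderiv i p) (x + t *: e_ i)).
Proof.
move: p; apply: mpoly_ring_ind.
- move=> c; rewrite mderivC.
  rewrite (_ : (fun s => _) = cst c); last by apply/funext => s; rewrite pevalC.
  by rewrite (_ : peval 0 _ = 0); [exact: is_derive_cst|exact: meval0].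
- move=> k.
  rewrite (_ : (fun s => _) = (fun s => x ord0 k + s * (k == i)%:R)); last first.
    by apply/funext => s; rewrite pevalX !mxE eqxx.
  have -> : peval (mderiv i (X k)) (x + t *: e_ i) = (k == i)%:R.
    by rewrite mderivXX eq_sym; case: eqP => _; [exact: pevalC|exact: meval0].
  apply: is_derive_eq; rewrite ?scaler0 ?add0r ?addr0.
  by rewrite [LHS]mul1r [LHS]mulr1.
- move=> p q pD qD; rewrite mderivD pevalD.
  rewrite (_ : (fun s => _) = (fun s => peval p (x + s *: e_ i)) +
     (fun s => peval q (x + s *: e_ i))); first exact: is_deriveD.
  by apply/funext => s; rewrite pevalD.
- move=> p q pD qD; rewrite mderivM pevalD !pevalM.
  rewrite (_ : (fun s => _) = (fun s => peval p (x + s *: e_ i)) *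
     (fun s => peval q (x + s *: e_ i))); last first.
    by apply/funext => s; rewrite pevalM.
  by apply: is_derive_eq; rewrite addrC mulrC.
Qed.

Lemma is_derive_line u i x t :
  has_partial i u (x + t *: e_ i) ->
  is_derive t (1 : R) (fun s => u (x + s *: e_ i)) (partial i u (x + t *: e_ i)).
Proof.
pose f (s : R) := u (x + s *: e_ i); pose y := x + t *: e_ i.
have E : (fun a : R => a^-1 *: ((f \o shift t) (a *: (1 : R)) - f t)) =
    (fun a : R => a^-1 *: ((u \o shift y) (a *: e_ i) - u y)).
  apply/funext => a; rewrite /f /y /=.
  by rewrite [a%:A]mulr1 scalerDl addrCA.
move=> hp; split; first by rewrite /derivable E.
by rewrite /partial /derive E.
Qed.

Lemma enorm_line_lt x i (r : R) : enorm x < r ->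
  exists2 e : R, 0 < e & forall t, `|t| < e -> enorm (x + t *: e_ i) < r.
Proof.
move=> xr; have r0 : 0 < r by rewrite (le_lt_trans _ xr)// enorm_ge0.
have gap : 0 < r ^+ 2 - enorm x ^+ 2.
  by rewrite subr_gt0 ltr_pXn2r// ?nnegrE ?enorm_ge0 ?ltW.
(* For [|t| < 1], moving by [t] along axis [i] changes the squared norm by at most [|t| * K]. *)
pose K := 2 * `|x ord0 i| + 1.
have K0 : 0 < K by rewrite ltr_wpDl// mulr_ge0.
exists (Num.min 1 ((r ^+ 2 - enorm x ^+ 2) / K)).
  by rewrite lt_min ltr01 divr_gt0.
move=> t; rewrite lt_min => /andP[t1 tK].
rewrite -(@ltr_pXn2r _ 2)// ?nnegrE ?enorm_ge0 ?ltW// sqr_enorm.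
have -> : \sum_k (x + t *: e_ i) ord0 k ^+ 2 =
    enorm x ^+ 2 + (2 * t * x ord0 i + t ^+ 2).
  rewrite sqr_enorm (bigD1 i)//= [in RHS](bigD1 i)//= !mxE !eqxx /= mulr1.
  rewrite (eq_bigr (fun k => x ord0 k ^+ 2)) => [|k ki]; first by ring.
  by rewrite !mxE (negbTE ki) andbF mulr0 addr0.
rewrite -ltrBrDl (le_lt_trans (ler_norm _))//.
rewrite ltr_pdivlMr// in tK; rewrite (le_lt_trans _ tK)//.
rewrite (le_trans (ler_normD _ _))// /K mulrDr mulr1 normrX expr2 !normrM ger0_norm//.
rewrite mulrAC mulrA mulrAC [_ * 2]mulrC lerD// ler_piMr// ltW//.
Qed.

(** The second derivatives along the axes are nonpositive at such a point, and their sum is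
    [- lap p] since [u] is harmonic. The factor [s], later 1 or -1, serves upper and lower bounds
    alike. *)
Lemma harmonic_local_max (s rho : R) u p x : harmonic_on (eball rho) u ->
  eball rho x -> (forall i, exists2 e : R, 0 < e & forall t, `|t| < e ->
    s * u (x + t *: e_ i) - peval p (x + t *: e_ i) <= s * u x - peval p x) ->
  0 <= peval (lap p) x.
Proof.
move=> [[_ u1 u2] lu] xr xmax.
suff le_i i : s * partial i (partial i u) x - peval (mderiv i (mderiv i p)) x <= 0.
  have : \sum_i (s * partial i (partial i u) x -
      peval (mderiv i (mderiv i p)) x) <= 0 by exact: sumr_le0.
  rewrite sumrB -mulr_sumr -/(laplacian u x) lu// mulr0 sub0r oppr_le0.
  by rewrite /lap peval_sum.
have [e1 e10 le1] := enorm_line_lt i xr.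
have [e2 e20 le2] := xmax i.
pose e := Num.min e1 e2.
have e0 : 0 < e by rewrite lt_min e10.
have x0 (w : 'rV[R]_d -> R) : w x = w (x + 0 *: e_ i) by rewrite scale0r addr0.
pose F t := s * u (x + t *: e_ i) - peval p (x + t *: e_ i).
pose G t := s * partial i u (x + t *: e_ i) - peval (mderiv i p) (x + t *: e_ i).
have dF (w : 'rV[R]_d -> R) q t : has_partial i w (x + t *: e_ i) ->
    is_derive t 1 (fun t => s * w (x + t *: e_ i) - peval q (x + t *: e_ i))
      (s * partial i w (x + t *: e_ i) - peval (mderiv i q) (x + t *: e_ i)).
  move=> /is_derive_line hw; have hq := is_derive_peval_line q i x t.
  rewrite (_ : (fun t => _) = (s \*: (fun t => w (x + t *: e_ i))) -
    (fun t => peval q (x + t *: e_ i)))//.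
  by apply: is_deriveB; exact: is_deriveZ.
apply: (@local_max_second_derivative R F G e) => //.
- move=> t; rewrite lt_min => /andP[t1 _]; apply: dF.
  by have [] := u1 i _ (le1 t t1).
- rewrite (x0 (partial i (partial i u))) (x0 (peval (mderiv i (mderiv i p)))).
  by apply: dF; rewrite scale0r addr0; have [] := u2 i i x xr.
- by move=> t; rewrite lt_min /F => /andP[_ t2]; rewrite scale0r addr0; exact: le2.
Qed.

Lemma continuous_peval p : continuous (peval p).
Proof.
move: p; apply: mpoly_ring_ind.
- move=> c; rewrite (_ : peval _ = cst c); first exact: cst_continuous.
  by apply/funext => x; rewrite pevalC.
- move=> i; rewrite (_ : peval _ = fun x => x ord0 i).
    exact: coord_continuous.
  by apply/funext => x; rewrite pevalX.
- move=> p q cp cq x; rewrite (_ : peval _ = peval p + peval q).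
    by apply: continuousD; [exact: cp|exact: cq].
  by apply/funext => y; rewrite pevalD.
- move=> p q cp cq x; rewrite (_ : peval _ = peval p * peval q).
    by apply: continuousM; [exact: cp|exact: cq].
  by apply/funext => y; rewrite pevalM.
Qed.

Lemma continuous_enorm : continuous (@enorm R d).
Proof.
move=> x; rewrite (_ : @enorm R d = Num.sqrt \o peval normsq).
  by apply: continuous_comp; [exact: continuous_peval|exact: sqrt_continuous].
by apply/funext => y; rewrite /= peval_normsq sqrtr_sqr ger0_norm// enorm_ge0.
Qed.

Definition cball (r : R) : set 'rV[R]_d := [set x | enorm x <= r].

Lemma compact_cball r : compact (cball r).
Proof.
apply: (subclosed_compact _ (rV_compact (fun=> @segment_compact R (- r) r))).
  apply: (closed_comp (f := @enorm R d) (D := [set a | a <= r])).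
    by move=> x _; exact: continuous_enorm.
  exact: closed_le.
move=> x xr i; rewrite /= in_itv /= -ler_norml.
exact: le_trans (normr_coord_enorm x i) xr.
Qed.

(** Strict negativity of [lap p] excludes an interior maximum at once, so the maximum on the compact
    ball lies on the sphere. *)
Lemma harmonic_maximum (s rho r M : R) u p : 0 < r -> r < rho ->
  harmonic_on (eball rho) u -> (forall x, peval (lap p) x < 0) ->
  (forall x, enorm x = r -> s * u x - peval p x <= M) ->
  forall x, enorm x <= r -> s * u x - peval p x <= M.
Proof.
move=> r0 rrho hu lp uM x xr.
pose w y := s * u y - peval p y.
have uc y : cball r y -> {for y, continuous w}.
  move=> yr; apply: continuousB; last exact: continuous_peval.
  apply: continuousM; first exact: cst_continuous.
  by have [[uc _ _] _] := hu; apply: uc; exact: le_lt_trans rrho.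
have [|y] := EVT_max_rV (f := w) (ex_intro _ x xr) (@compact_cball r).
  by apply: continuous_in_subspaceT => y; rewrite inE; exact: uc.
rewrite inE /cball /= => yr ymax.
have {ymax} ymax z : enorm z <= r -> w z <= w y by move=> zr; apply: ymax; rewrite inE.
apply: le_trans (ymax x xr) _.
have [/uM//|yr'] := eqVneq (enorm y) r.
have {yr yr'} yr : enorm y < r by rewrite lt_neqAle yr' yr.
have yrho : eball rho y by exact: lt_trans rrho.
suff : 0 <= peval (lap p) y by rewrite leNgt lp.
apply: (@harmonic_local_max s rho u p y) => // i.
have [e e0 le_e] := enorm_line_lt i yr; exists e => // t te.
by apply: ymax; apply: ltW; exact: le_e.
Qed.

Lemma harmonic_approx (rho r e : R) u h : (0 < d)%N -> 0 < r -> r < rho ->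
  harmonic_on (eball rho) u -> lap h = 0 ->
  (forall x, enorm x = r -> `|u x - peval h x| <= e) ->
  forall x, enorm x <= r -> `|u x - peval h x| <= e.
Proof.
move=> d0 r0 rrho hu lh uh x xr.
have key (s : R) : (forall x, enorm x = r -> s * (u x - peval h x) <= e) ->
    s * (u x - peval h x) <= e.
  move=> se; apply/ler_addgt0Pl => eps eps0.
  (* Adding [del * |x|^2] makes the Laplacian of the difference strictly positive and costs exactly
     [eps] on the sphere. *)
  pose del := eps / r ^+ 2.
  have r20 : 0 < r ^+ 2 by rewrite exprn_gt0.
  have del0 : 0 < del by rewrite divr_gt0.
  pose p := s *: h - del *: normsq.
  have pE y : s * u y - peval p y = s * (u y - peval h y) + del * enorm y ^+ 2.
    by rewrite /p pevalB !pevalZ peval_normsq; ring.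
  have lap_lt y : peval (lap p) y < 0.
    rewrite /p lapB !lapZ lh scaler0 sub0r.
    have -> : lap normsq = (2 * d)%:R :> mp.
      have h1 : homog 0 (1 : mp) by rewrite /homog dhomog1.
      have := lap_normsqM h1; rewrite (homog_lap_lt2 _ h1)//.
      by rewrite !mulr1 mulr0 add0r muln0 addn0.
    rewrite -mpolyC_nat -scaleN1r !pevalZ pevalC mulN1r oppr_lt0 mulr_gt0//.
    by rewrite ltr0n muln_gt0.
  have uM y : enorm y = r -> s * u y - peval p y <= e + eps.
    by move=> yr; rewrite pE yr lerD ?se// /del divfK// gt_eqF.
  have := harmonic_maximum r0 rrho hu lap_lt uM xr.
  have : 0 <= del * enorm x ^+ 2 by rewrite mulr_ge0 ?sqr_ge0// ltW.
  by rewrite pE; lra.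
have k1 := key 1; have kN := key (-1); rewrite !mul1r !mulN1r in k1 kN.
rewrite ler_norml; apply/andP; split.
  by rewrite lerNl; apply: kN => y /uh; rewrite mulN1r ler_norml => /andP[]; lra.
by apply: k1 => y /uh; rewrite mul1r ler_norml => /andP[].
Qed.

End maximum_principle.

(** * Polynomial approximation *)

Section uniform_continuity_on_compacts.
Context {R : realType} {d : nat}.

(** Unlike in Heine's theorem, [z] may leave [K]: the grid points of the Bernstein polynomial near a
    point of the ball can lie outside it. *)
Lemma compact_uniform_near (K : set 'rV[R]_d) (w : 'rV[R]_d -> R) (e : R) :
  compact K -> (forall x, K x -> {for x, continuous w}) -> 0 < e ->
  exists2 del : R, 0 < del &
    forall x z, K x -> `|z - x| < del -> `|w z - w x| <= e.
Proof.
move=> cK wc e0; have := compact_near_coveringP K => -[/(_ cK) nK _].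
pose P (del : R) (x : 'rV[R]_d) := forall z, `|z - x| < del -> `|w z - w x| <= e.
have e2 : 0 < e / 2 by rewrite divr_gt0.
have nP : forall x, K x -> \forall x' \near x & del \near 0^'+, P del x'.
  move=> x /wc wx; have /cvgrPdist_lt/(_ _ e2) := wx.
  move=> /nbhs_ballP[a /= a0 wa].
  exists (ball x (a / 2), [set t | t < a / 2]) => /=.
    split; first by apply: nbhsx_ballx; rewrite divr_gt0.
    by apply: nbhs_right_lt; rewrite divr_gt0.
  move=> [y t] [/= xy ta] z zy.
  have ya : `|x - y| < a / 2 by move: xy; rewrite -ball_normE.
  have wy : `|w x - w y| < e / 2.
    by apply: wa; rewrite -ball_normE /= (lt_trans ya)// ltr_pdivrMr// ltr_pMr// ltr1n.
  have wz : `|w x - w z| < e / 2.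
    apply: wa; rewrite -ball_normE /= -(subrKA y) (le_lt_trans (ler_normD _ _))//.
    by rewrite [a]splitr ltrD// distrC (lt_trans zy).
  rewrite -(subrKA (w x)) (le_trans (ler_normD _ _))// [e]splitr lerD// ltW//.
  by rewrite distrC.
have [t [Kt t0]] := @filter_ex _ (0 : R)^'+ _ _
  (filterI (nK R (0 : R)^'+ P _ nP) (nbhs_right_gt 0)).
by exists t => // x z Kx; exact: Kt.
Qed.

End uniform_continuity_on_compacts.

Section bernstein.
Context {R : realType} {d : nat}.
Local Notation mp := (mpoly d R).
Local Notation X i := (mpolyX R (mnm1 i) : mp).
Implicit Types (p : mp) (i j : 'I_d) (x y : 'rV[R]_d) (k : 'I_d -> nat).
Implicit Types (s : seq 'I_d) (f g : ('I_d -> nat) -> R).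

Definition incr i k j := ((i == j) + k j)%N.

(* The expectation of f at the end of a random walk on Z^d started at 0, whose
   successive steps are 0 or the unit vectors e_i for i in s, with probability
   y_i of moving. For s running n times through the axes this is the Bernstein
   polynomial of f. *)
Fixpoint walk_mean (y : 'rV[R]_d) s f : R :=
  if s is i :: s' then
    (1 - y ord0 i) * walk_mean y s' f + y ord0 i * walk_mean y s' (f \o incr i)
  else f (fun=> 0%N).

Lemma walk_mean_le y s f g : (forall i, 0 <= y ord0 i <= 1) ->
  (forall k, f k <= g k) -> walk_mean y s f <= walk_mean y s g.
Proof.
move=> y01; elim: s f g => [|i s IH] f g fg /=; first exact: fg.
have /andP[y0 y1] := y01 i.
apply: lerD; apply: ler_wpM2l => //; [by rewrite subr_ge0|exact: IH|].
by apply: IH => k; exact: fg.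
Qed.

(** Variance plus squared bias: coordinate [j] of the walk is binomial with [c] trials of
    probability [y_j], and this is its mean squared distance to [a j]. *)
Definition walk_var y s (a : 'I_d -> R) j : R :=
  let c := (count_mem j s)%:R in
  c * (y ord0 j * (1 - y ord0 j)) + (c * y ord0 j - a j) ^+ 2.

(** Evaluates the two quadratic functions that enclose the sampled function in [peval_approx]. A
    step of the walk amounts to a shift of [a], which is therefore general in the induction. *)
Lemma walk_mean_sqr y s (b C : R) (a : 'I_d -> R) :
  walk_mean y s (fun k => b + C * \sum_j ((k j)%:R - a j) ^+ 2) =
  b + C * \sum_j walk_var y s a j.
Proof.
elim: s a => [|i s IH] a /=.
  by congr (_ + _ * _); apply: eq_bigr => j _; rewrite /walk_var /= mulr0n !mul0r !add0r.
rewrite IH.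
have -> : (fun k => b + C * \sum_j ((k j)%:R - a j) ^+ 2) \o incr i =
    (fun k => b + C * \sum_j ((k j)%:R - (a j - (i == j)%:R)) ^+ 2).
  apply/funext => k /=; congr (_ + _ * _); apply: eq_bigr => j _.
  by rewrite /incr natrD; congr (_ ^+ 2); ring.
rewrite IH.
transitivity (b + C * ((1 - y ord0 i) * \sum_j walk_var y s a j +
    y ord0 i * \sum_j walk_var y s (fun j => a j - (i == j)%:R) j)); first by ring.
congr (_ + _ * _); rewrite !mulr_sumr -big_split; apply: eq_bigr => j _ /=.
rewrite /walk_var /= natrD.
by have [->|_] := eqVneq i j; rewrite /= ?mulr1n ?mulr0n; ring.
Qed.

Lemma walk_mean_peval (a b : R) s f : exists p : mp,
  forall x, peval p x = walk_mean (a *: (x + const_mx b)) s f.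
Proof.
elim: s f => [|i s IH] f /=.
  by exists (mpolyC d (f (fun=> 0%N))) => x; rewrite pevalC.
have [p pE] := IH f; have [q qE] := IH (f \o incr i).
pose Y : mp := a *: (X i + mpolyC d b).
exists ((mpolyC d 1 - Y) * p + Y * q) => x.
rewrite pevalD !pevalM pevalB pevalC pevalZ pevalD pevalX pevalC pE qE.
by rewrite !mxE.
Qed.

Lemma peval_approx (u : 'rV[R]_d -> R) (r rho e : R) : (0 < d)%N ->
  0 < r -> r < rho -> (forall x, eball rho x -> {for x, continuous u}) -> 0 < e ->
  exists p : mp, forall x, enorm x <= r -> `|u x - peval p x| <= e.
Proof.
move=> d0 r0 rrho uc e0.
(* An intermediate radius, so that points close to the ball of radius [r] stay where [u] is
   continuous and bounded. *)
pose r' := (r + rho) / 2.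
have rr' : r < r' by rewrite /r'; lra.
have r'rho : r' < rho by rewrite /r'; lra.
have cK := @compact_cball R d.
have ucK r1 : r1 < rho -> forall x, cball r1 x -> {for x, continuous u}.
  by move=> r1rho x xr; apply: uc; exact: le_lt_trans r1rho.
have e2 : 0 < e / 2 by rewrite divr_gt0.
have [d1 d10 ud1] := compact_uniform_near (cK r) (ucK r rrho) e2.
have ec x : cball r x -> {for x, continuous (@enorm R d)}.
  by move=> _; exact: continuous_enorm.
have rr0 : 0 < r' - r by rewrite subr_gt0.
have [d2 d20 nd2] := compact_uniform_near (cK r) ec rr0.
have [d3 d30 [d31 d32]] : exists2 d3, 0 < d3 & d3 <= d1 /\ d3 <= d2.
  exists (Num.min d1 d2); first by rewrite lt_min d10.
  by split; rewrite ge_min lexx ?orbT.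
have [M M0 uM] : exists2 M, 0 < M & forall x, enorm x <= r' -> `|u x| <= M.
  have c0 : cball r' (0 : 'rV[R]_d) by rewrite /cball /= enorm0; lra.
  have [|z zr zmax] := EVT_max_rV (f := fun x => `|u x|) (ex_intro _ _ c0) (cK r').
    apply: continuous_in_subspaceT => x; rewrite inE => /(ucK _ r'rho) ux.
    exact: (continuous_comp ux (@norm_continuous _ _ _)).
  exists (`|u z| + 1); first by rewrite ltr_wpDl.
  by move=> x xr; rewrite (le_trans (zmax x _)) ?inE// lerDl.
(* The grid fills the cube [[-r, r]^d], which can stick out of the domain of control of [u]; the
   extension by 0 keeps the bound [M]. *)
pose F z := if enorm z <= r' then u z else 0.
(* If some coordinate of [z - x] is at least [d3], its square alone brings the quadratic term up to
   [2 * M], which bounds [|F z - u x|]. *)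
pose C := 2 * M / d3 ^+ 2.
have C0 : 0 <= C by rewrite divr_ge0 ?mulr_ge0 ?sqr_ge0// ltW.
have FM z : `|F z| <= M by rewrite /F; case: ifP => [/uM//|_]; rewrite normr0 ltW.
have FC x z : enorm x <= r ->
    `|F z - u x| <= e / 2 + C * \sum_j (z ord0 j - x ord0 j) ^+ 2.
  move=> xr; have sum0 : 0 <= \sum_j (z ord0 j - x ord0 j) ^+ 2.
    by apply: sumr_ge0 => j _; exact: sqr_ge0.
  have [zx|/forallPn[j]] := boolP [forall j, `|z ord0 j - x ord0 j| < d3].
    have {}zx : `|z - x| < d3.
      rewrite -[`|z - x|]/(mx_norm (z - x)) mx_normrE; apply/bigmax_ltP; split=> // -[a j] _ /=.
      by rewrite (ord1 a) !mxE; exact: (forallP zx).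
    have zr' : enorm z <= r'.
      have := nd2 x z xr (lt_le_trans zx d32); rewrite ler_norml => /andP[_].
      by rewrite lerBlDr => /le_trans; apply; rewrite -lerBrDl opprB addrCA subrr addr0.
    rewrite /F zr' (le_trans (ud1 x z xr (lt_le_trans zx d31)))//.
    by rewrite lerDl mulr_ge0.
  rewrite -leNgt => dj; rewrite (le_trans (ler_normB _ _))//.
  have xr' : enorm x <= r' by rewrite (le_trans xr)// ltW.
  apply: (@le_trans _ _ (C * d3 ^+ 2)).
    rewrite /C divfK; last by rewrite expf_eq0 /= gt_eqF.
    by have := FM z; have := uM x xr'; lra.
  apply: ler_wpDl; first exact: ltW.
  apply: ler_wpM2l => //; rewrite (bigD1 j)//=; apply: ler_wpDr.
    by apply: sumr_ge0 => i _; exact: sqr_ge0.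
  by rewrite -[leRHS]real_normK ?num_real// ler_pXn2r// nnegrE// ltW.
pose n := (Num.truncn (C * (2 * r) ^+ 2 * d%:R / (e / 2))).+1.
have n0 : 0 < n%:R :> R by rewrite ltr0n.
have nbig : C * (2 * r) ^+ 2 * d%:R / n%:R <= e / 2.
  rewrite ler_pdivrMr// [leRHS]mulrC -ler_pdivrMr//.
  by apply/ltW; exact: truncnS_gt.
pose s := flatten (nseq n (enum 'I_d)).
have sn j : count_mem j s = n.
  rewrite /s; elim: (n) => //= m IH.
  by rewrite count_cat IH count_uniq_mem ?enum_uniq// mem_enum.
pose grid k : 'rV[R]_d := \row_j (2 * r / n%:R * (k j)%:R - r).
have [p pE] := walk_mean_peval (2 * r)^-1 r s (F \o grid).
exists p => x xr; rewrite pE.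
set y := _ *: _.
have r2 : 0 < 2 * r by rewrite mulr_gt0.
have yE j : y ord0 j = (x ord0 j + r) / (2 * r) by rewrite !mxE mulrC.
have y01 j : 0 <= y ord0 j <= 1.
  have := le_trans (normr_coord_enorm x j) xr; rewrite ler_norml yE => /andP[x1 x2].
  rewrite ler_pdivrMr// mul1r; apply/andP; split; last by lra.
  by apply: divr_ge0; [lra|exact: ltW].
pose b := C * (2 * r / n%:R) ^+ 2.
have b0 : 0 <= b by rewrite mulr_ge0// sqr_ge0.
have gridE k : `|F (grid k) - u x| <=
    e / 2 + b * \sum_j ((k j)%:R - n%:R * y ord0 j) ^+ 2.
  apply: le_trans (FC x (grid k) xr) _; rewrite lerD2l /b -mulrA ler_wpM2l//.
  rewrite mulr_sumr; apply: ler_sum => j _; rewrite yE !mxE -exprMn.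
  rewrite le_eqVlt; apply/orP; left; apply/eqP; congr (_ ^+ 2).
  by field; rewrite !gt_eqF.
(* Centring at [n y_j] removes the bias and leaves a variance of at most [n] per coordinate. Since
   [b] carries [1 / n^2], the total is at most [C (2 r)^2 d / n], which the choice of [n] makes
   small. *)
have var_le : b * \sum_j walk_var y s (fun j => n%:R * y ord0 j) j <= e / 2.
  apply: le_trans nbig.
  have -> : C * (2 * r) ^+ 2 * d%:R / n%:R = b * (d%:R * n%:R).
    by rewrite /b; field; rewrite gt_eqF.
  apply: ler_wpM2l => //.
  have -> : d%:R * n%:R = \sum_(j < d) n%:R :> R.
    by rewrite sumr_const card_ord mulr_natl.
  apply: ler_sum => j _; rewrite /walk_var sn subrr expr0n addr0.
  rewrite ler_piMr//; have /andP[y0 y1] := y01 j.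
  by rewrite mulr_ile1// ?subr_ge0// lerBlDr lerDl.
have up := walk_mean_le s y01 (f := F \o grid)
  (g := fun k => (u x + e / 2) + b * \sum_j ((k j)%:R - n%:R * y ord0 j) ^+ 2).
have lo := walk_mean_le s y01 (g := F \o grid)
  (f := fun k => (u x - e / 2) + (- b) * \sum_j ((k j)%:R - n%:R * y ord0 j) ^+ 2).
rewrite !walk_mean_sqr in up lo.
have {}up : walk_mean y s (F \o grid) <= u x + e.
  apply: (le_trans (up _)) => [k|]; last by move: var_le; lra.
  by have := gridE k; rewrite ler_norml => /andP[_] /=; lra.
have {}lo : u x - e <= walk_mean y s (F \o grid).
  apply: (le_trans _ (lo _)) => [|k]; first by move: var_le; lra.
  by have := gridE k; rewrite ler_norml => /andP[+ _] /=; lra.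
by rewrite ler_norml; apply/andP; split; lra.
Qed.

End bernstein.

(** * Spherical means of squares of harmonic functions *)

Section spherical_means.
Context {R : realType} {d : nat}.
Hypothesis d0 : (0 < d)%N.
Variables (rho : R) (u : 'rV[R]_d -> R).
Hypothesis rho0 : 0 < rho.
Hypothesis hu : harmonic_on (eball rho) u.

Lemma harmonic_polynomial_approx (r e : R) : 0 < r -> r < rho -> 0 < e ->
  exists h : mpoly d R,
    lap h = 0 /\ forall x, enorm x <= r -> `|u x - peval h x| <= e.
Proof.
move=> r0 rrho e0; have [[uc _ _] _] := hu.
have [p up] := peval_approx d0 r0 rrho uc e0.
have [h lh hp] := mpoly_dirichlet p r d0.
exists h; split=> //; apply: (harmonic_approx d0 r0 rrho hu lh) => x xr.
by rewrite hp// up// xr.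
Qed.

(** These radii start at [rho / 2] and increase to [rho], so a single sequence of polynomials serves
    every [s < rho]. *)
Let rad n : R := rho - rho / 2 * @harmonic R n.

Lemma harmonic_polynomial_sequence : exists h_ : nat -> mpoly d R,
  (forall n, lap (h_ n) = 0) /\
  forall n x, enorm x <= rad n -> `|u x - peval (h_ n) x| <= @harmonic R n.
Proof.
have /choice[h_ h_P] : forall n, exists h : mpoly d R, lap h = 0 /\
    forall x, enorm x <= rad n -> `|u x - peval h x| <= @harmonic R n.
  move=> n; have hn : 0 < @harmonic R n by rewrite invr_gt0.
  have hn1 : @harmonic R n <= 1 by rewrite invf_le1 ?ler1n.
  apply: harmonic_polynomial_approx => //.
    rewrite subr_gt0 (@le_lt_trans _ _ (rho / 2))//.
      by rewrite ler_piMr// divr_ge0// ltW.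
    by rewrite ltr_pdivrMr// ltr_pMr// ltr1n.
  by rewrite ltrBlDr ltrDl mulr_gt0// divr_gt0.
by exists h_; split=> n; have [] := h_P n.
Qed.

Lemma cvg_sphere_average_sqr : exists2 P_ : nat -> {poly R},
  (forall n k, 0 <= (P_ n)`_k) &
  forall s, 0 <= s < rho ->
    (P_ n).[s] @[n --> \oo] --> sphere_average (fun x => u x ^+ 2) s.
Proof.
have [h_ [lh uh]] := harmonic_polynomial_sequence.
have /choice[P_ P_P] : forall n, exists P : {poly R}, (forall k, 0 <= P`_k) /\
    forall r, 0 <= r -> sphere_average (fun x => peval (h_ n) x ^+ 2) r = P.[r].
  by move=> n; have [P P0 PE] := poly_average_sqr_harmonic d0 (lh n); exists P.
exists P_ => [n k|s /andP[s0 srho]]; first by have [] := P_P n.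
have harm0 : @harmonic R n @[n --> \oo] --> 0 by exact: cvg_harmonic.
have radn : \forall n \near \oo, s <= rad n.
  have : rad n @[n --> \oo] --> rho.
    rewrite -[X in _ --> X]subr0 -[X in _ --> _ - X](mulr0 (rho / 2)).
    by apply: cvgB; [exact: cvg_cst|apply: cvgM => //; exact: cvg_cst].
  by move=> /cvgr_ge; apply.
have uhs : \forall n \near \oo, forall x, enorm x = s ->
    `|u x - peval (h_ n) x| <= @harmonic R n.
  by apply: filterS radn => n sn x xs; apply: uh; rewrite xs.
(* Measurability on the sphere is inherited from the polynomials, which are measurable for the
   sigma-algebra generated by the coordinates. *)
have mu : measurable_fun (esphere s) u.
  apply: (measurable_fun_cvg (h := fun n => peval (h_ n))).
    by move=> n; apply: measurable_funTS; exact: measurable_peval.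
  move=> x xs; apply/cvgrPdist_le => e e0.
  have he : \forall n \near \oo, `|@harmonic R n| <= e.
    by move/cvgrPdist_le : harm0 => /(_ _ e0); apply: filterS => n; rewrite sub0r normrN.
  apply: filterS2 uhs he => n /(_ x xs) ux he.
  by rewrite (le_trans ux)// (le_trans (ler_norm _)).
have [M uM] : exists M : R, forall x, enorm x = s -> `|u x| <= M.
  have [n un] := filter_ex uhs.
  have [_ [M hM]] := sphere_bounded_peval s (h_ n).
  exists (@harmonic R n + M) => x xs; rewrite -(subrK (peval (h_ n) x) (u x)).
  by rewrite (le_trans (ler_normD _ _))// lerD ?un ?hM.
(* The factor [2 * M + 1] bounds [|u + h_n|], written as [2 u - (u - h_n)], because the error
   [1 / (n + 1)] is at most 1. *)
have sqr_dist n x : (forall x, enorm x = s ->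
    `|u x - peval (h_ n) x| <= @harmonic R n) -> enorm x = s ->
    `|u x ^+ 2 - peval (h_ n) x ^+ 2| <= @harmonic R n * (2 * M + 1).
  move=> uhn xs; rewrite subr_sqr normrM; apply: ler_pM => //; first exact: uhn.
  have hn1 : @harmonic R n <= 1 by rewrite invf_le1 ?ler1n.
  have -> : u x + peval (h_ n) x = 2 * u x - (u x - peval (h_ n) x) by ring.
  rewrite (le_trans (ler_normB _ _))//; apply: lerD.
    by rewrite normrM ger0_norm// ler_wpM2l// uM.
  by rewrite (le_trans (uhn x xs)).
have dist n : (forall x, enorm x = s ->
    `|u x - peval (h_ n) x| <= @harmonic R n) ->
    `|sphere_average (fun x => u x ^+ 2) s - (P_ n).[s]| <=
    @harmonic R n * (2 * M + 1).
  move=> uhn; have [_ <-//] := P_P n.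
  move: s0; rewrite le_eqVlt => /predU1P[s0|s0].
    by rewrite -s0 /sphere_average eqxx; apply: sqr_dist => //; rewrite enorm0.
  apply: sphere_average_dist => //; last by move=> x; exact: sqr_dist.
  - split; first exact: measurable_funX.
    by exists (M ^+ 2) => x xs; rewrite normrX lerXn2r ?nnegrE ?(le_trans _ (uM x xs))// uM.
  - rewrite (_ : (fun x => _) = peval (h_ n * h_ n)).
      exact: sphere_bounded_peval.
    by apply/funext => x; rewrite pevalM.
apply/cvgrPdist_le => e e0.
have he : \forall n \near \oo, @harmonic R n * (2 * M + 1) <= e.
  have : @harmonic R n * (2 * M + 1) @[n --> \oo] --> 0.
    rewrite -[X in _ --> X](mul0r (2 * M + 1)).
    by apply: cvgM => //; exact: cvg_cst.
  by move=> /cvgr_le; apply.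
by apply: filterS2 uhs he => n /dist; exact: le_trans.
Qed.

End spherical_means.

Theorem theorem1p4 (R : realType) (d : nat) (hd : (0 < d)%N)
    (rho : R) (hrho : 0 < rho) (u : 'rV[R]_d -> R)
    (hu : harmonic_on (eball rho) u) :
  absolutely_monotonic rho (sphere_average (fun x => u x ^+ 2)).
Proof.
have [P_ P0 Pu] := cvg_sphere_average_sqr hd hrho hu.
exact: cvg_poly_absolutely_monotonic P0 Pu.
Qed.
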